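(* Let $A=(a_1,\dots,a_n)$ be positive integers with $a_1\le\dots\le a_n=k+1$. Let $\widetilde W^A=\mathbb C[e_0,\dots,e_{n-1}]\,v_A\subset F^{\otimes k}$. Then $\widetilde W^A\cong W^A$ as $\mathbb C[e_0,\dots,e_{n-1}]$-modules.
   Context: The module $W^A$: let $e^{(n)}(z)=\sum_{i=0}^{n-1}e_iz^i$ and $s_+=\max(s,0)$. $W^A=\mathbb C[e_0,\dots,e_{n-1}]/J^A$, where $J^A$ is the ideal expressing the conditions that $e^{(n)}(z)^i$ is divisible by $z^{\sum_{j=1}^n(i+1-a_j)_+}$ for $i=1,2,\dots$; i.e. $J^A$ is generated by the coefficients of $z^m$, $0\le m<\sum_{j=1}^n(i+1-a_j)_+$, in $e^{(n)}(z)^i$, $i\ge 1$. The space $F$: let $\psi(i),\phi(i)$, $i\in\mathbb Z$, be mutually anticommuting variables with $\psi(i)^2=\phi(i)^2=0$. $F$ is the complex vector space with basis the semi-infinite monomials $\dots\psi(N-1)\phi(N-1)\psi(N)\phi(N)\,\psi(i_1)\cdots\psi(i_s)\,\phi(j_1)\cdots\phi(j_t)$, $N<i_1<\dots<i_s$, $N<j_1<\dots<j_t$ (identified, up to the reordering sign, when they consist of the same fermions). $\psi(i),\phi(i)$ act on $F$ by (right) multiplication. Put $e(z)=\sum_{i\in\mathbb Z}e_iz^i=\psi(z)\phi(z)$ with $\psi(z)=\sum_i\psi(i)z^i$, $\phi(z)=\sum_i\phi(i)z^i$, i.e. $e_m=\sum_{i+j=m}\psi(i)\phi(j)$; the $e_m$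 commute. On $F^{\otimes k}$ each $e_m$ acts by the coproduct $\sum_r \mathrm{Id}^{\otimes(r-1)}\otimes e_m\otimes\mathrm{Id}^{\otimes(k-r)}$ ($F^{\otimes 0}=\mathbb C$ with zero action). Vectors: $v(2N)=\dots\psi(N-1)\phi(N-1)\psi(N)$, $v(2N+1)=\dots\psi(N-1)\phi(N-1)\psi(N)\phi(N)$, $N\in\mathbb Z$. With $d_j=\#\{i:a_i=j\}$, $j=1,\dots,k+1$, $$v_A=v(-1+d_1)\otimes v(-1+d_1+d_2)\otimes\cdots\otimes v(-1+d_1+\cdots+d_k)\in F^{\otimes k}.$$ *)

(* Defs.v *)
From HB Require Import structures.
From mathcomp Require Import all_boot all_order all_algebra.
From mathcomp Require Import finmap complex.
From mathcomp Require Import boolp classical_sets functions cardinality fsbigop.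
From mathcomp Require Import reals.
From mathcomp Require Import monalg.
From mathcomp Require Import zify ring.

Set Implicit Arguments.
Unset Strict Implicit.
Unset Printing Implicit Defensive.

Import Order.TTheory GRing.Theory Num.Theory.

Local Open Scope classical_set_scope.
Local Open Scope ring_scope.

HB.lock Definition linext (K : comNzRingType) (T : choiceType) (V : lmodType K)
    (f : T -> V) (g : {malg K[T]}) : V :=
  \sum_(b <- msupp g) g@_b *: f b.

Section LinearExtension.
Variables (K : comNzRingType) (T : choiceType) (V : lmodType K).
Implicit Types (f : T -> V) (g : {malg K[T]}).

Lemma linextEw f (d : {fset T}) g : (msupp g `<=` d)%fset ->
  linext f g = \sum_(b <- d) g@_b *: f b.
Proof.
move=> sgd; rewrite linext.unlock; apply: big_fset_incl => // b _ bNg.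
by rewrite mcoeff_outdom // scale0r.
Qed.

Lemma linext_is_linear f : linear (linext f).
Proof.
move=> a g h; pose d := (msupp g `|` msupp h)%fset.
have sg : (msupp g `<=` d)%fset by rewrite fsubsetUl.
have sh : (msupp h `<=` d)%fset by rewrite fsubsetUr.
have sgh : (msupp (a *: g + h) `<=` d)%fset.
  apply: fsubset_trans (msuppD_le _ _) _; rewrite fsubUset sh andbT.
  exact: fsubset_trans (msuppZ_le _ _) sg.
rewrite (linextEw _ sg) (linextEw _ sh) (linextEw _ sgh).
rewrite scaler_sumr -big_split /=; apply: eq_bigr => b _.
by rewrite mcoeffD mcoeffZ scalerDl scalerA.
Qed.

HB.instance Definition _ f :=
  GRing.isLinear.Build K {malg K[T]} V *:%R (linext f) (linext_is_linear f).

Lemma linext0 f : linext f 0 = 0.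
Proof. exact: linear0. Qed.

Lemma linextP f a g h : linext f (a *: g + h) = a *: linext f g + linext f h.
Proof. exact: linearP. Qed.

Lemma linextU f b : linext f << b >> = f b.
Proof.
have s : (msupp (<< b >> : {malg K[T]}) `<=` [fset b])%fset by exact: msuppU_le.
by rewrite (linextEw _ s) big_seq_fset1 mcoeffUU scale1r.
Qed.

Lemma malg_decomp g : g = \sum_(b <- msupp g) g@_b *: << b >>.
Proof.
rewrite {1}[g]monalgE; apply: eq_bigr => b _.
by apply/malgP => c; rewrite mcoeffZ !mcoeffU mulr_natr.
Qed.

Lemma malg_lin_ind (P : {malg K[T]} -> Prop) :
  P 0 -> (forall a b g, P g -> P (a *: << b >> + g)) -> forall g, P g.
Proof.
move=> P0 PS g; rewrite [g]malg_decomp.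
by elim: (msupp g : seq T) => [|b s IH]; rewrite ?big_nil // big_cons; apply: PS.
Qed.

End LinearExtension.

(* The fermions are numbered by [int] in the order
   ..., psi(0), phi(0), psi(1), phi(1), ... *)
Definition psi (i : int) : int := 2 * i.
Definition phi (i : int) : int := 2 * i + 1.

(* Semi-infinite monomials are identified, up to a sign, when they consist of the
   same fermions: a basis of F is obtained by choosing, for each admissible set
   [S] of fermions, the monomial in which the elements of [S] are written in
   increasing order from left to right. *)
Definition semi_infinite (S : set int) : Prop :=
  exists2 N : int, (forall p, p <= N -> S p) & finite_set (S `&` [set p | N < p]).

Record fmonomial := FMonomial {
  occupied :> set int;
  occupiedP : `[< semi_infinite occupied >] }.

HB.instance Definition _ := [isSub for occupied].
HB.instance Definition _ := [Choice of fmonomial by <:].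

Lemma adjoin_subproof (b : fmonomial) (p : int) :
  `[< semi_infinite (p |` b) >].
Proof.
case: b => S /= /asboolP[N SN fS]; apply/asboolP; exists N.
  by move=> q qN; right; apply: SN.
rewrite setIUl finite_setU; split=> //.
by apply: sub_finite_set (finite_set1 p) => q [].
Qed.

Definition adjoin (b : fmonomial) (p : int) : fmonomial :=
  FMonomial (adjoin_subproof b p).

Lemma semi_infinite_above (b : fmonomial) (p : int) :
  finite_set (b `&` [set q | p < q]).
Proof.
case: b => S /= /asboolP[N SN fS].
apply: (@sub_finite_set _ _ ((S `&` [set q | N < q]) `|` [set` `]p, N]])).
  move=> q [Sq /= pq]; case: (ltP N q) => Nq; [by left|right].
  by rewrite /= in_itv /= pq.
rewrite finite_setU; split=> //.
apply: (@sub_finite_set _ _ ((fun j : nat => p + j%:Z) @` `I_(`|N - p|.+1))).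
  move=> q; rewrite /= in_itv /= => /andP[pq qN].
  by exists `|q - p|%N; lia.
exact: finite_image (finite_II _).
Qed.

Lemma anticomm_pairC (K : comNzRingType) (V : lmodType K)
    (f : int -> {linear V -> V}) :
  (forall p q x, f p (f q x) = - f q (f p x)) ->
  forall p q r s x, f p (f q (f r (f s x))) = f r (f s (f p (f q x))).
Proof.
move=> fC p q r s x.
rewrite (fC q r) linearN (fC p r) opprK (fC q s) !linearN.
by rewrite (fC p s) linearN opprK.
Qed.

Lemma linear_sum2 (K : comNzRingType) (V : lmodType K) (f g : {linear V -> V})
    (N : nat) (h : 'I_N -> V) : f (g (\sum_i h i)) = \sum_i f (g (h i)).
Proof. by rewrite !linear_sum. Qed.

Notation fock K := {malg K[fmonomial]}.

Section Fock.
Variable K : comNzRingType.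
Local Notation fock := (fock K).

Definition nb_above (b : fmonomial) (p : int) : nat :=
  #|` fset_set (b `&` [set q | p < q])|.

(* Right multiplication by the fermion p: it has to be moved to the left past the
   [nb_above b p] factors of the monomial that come after it. *)
Definition rmul_basis (p : int) (b : fmonomial) : fock :=
  if p \in (b : set int) then 0 else (-1) ^+ nb_above b p *: << adjoin b p >>.

Definition rmul (p : int) : fock -> fock := linext (rmul_basis p).
HB.instance Definition _ p := GRing.Linear.on (rmul p).

(* The sum of psi(i) phi(m - i) over all i; it is finite on every x, see
   [e_op_trunc]. As the action is on the right, psi(i) acts first. *)
Definition e_op (m : int) (x : fock) : fock :=
  \sum_(i \in [set: int]) rmul (phi (m - i)) (rmul (psi i) x).

Implicit Types (b : fmonomial) (p q : int) (x : fock).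

Lemma fmonomialP (b c : fmonomial) : (b : set int) = c -> b = c.
Proof. by move=> bc; apply: val_inj. Qed.

Lemma rmulU p b : rmul p << b >> = rmul_basis p b.
Proof. exact: linextU. Qed.

Lemma nb_above_adjoin b p q : q \notin (b : set int) ->
  nb_above (adjoin b q) p = (nb_above b p + (p < q)%R)%N.
Proof.
move=> qb; rewrite /nb_above /= setIUl.
have fb := semi_infinite_above b p.
case: (ltP p q) => pq; last first.
  rewrite addn0; congr #|` fset_set _|; rewrite (_ : [set q] `&` _ = set0) ?set0U //.
  by apply/seteqP; split=> // r [/= -> /lt_geF]; rewrite pq.
rewrite (_ : [set q] `&` _ = [set q]); last first.
  by apply/seteqP; split=> [r []//|r /= ->].
rewrite fset_setU1 // cardfsU1 in_fset_set // addn1.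
by rewrite (_ : q \in _ = false) //; apply: contraNF qb; rewrite !inE => -[].
Qed.

Lemma rmul_basisC p q b : rmul p (rmul q << b >>) = - rmul q (rmul p << b >>).
Proof.
rewrite !rmulU /rmul_basis.
have adjE r s : (r \in (adjoin b s : set int)) = (r == s) || (r \in (b : set int)).
  apply/idP/orP; first by rewrite in_setE => -[->|?]; [left|right; rewrite in_setE].
  by case=> [/eqP->|]; rewrite !in_setE; [left|right].
case: (boolP (p \in (b : set int))) => pb; case: (boolP (q \in (b : set int))) => qb;
  rewrite ?linear0 ?oppr0 //.
- by rewrite linearZ /= rmulU /rmul_basis adjE pb orbT scaler0.
- by rewrite linearZ /= rmulU /rmul_basis adjE qb orbT scaler0 oppr0.
rewrite !linearZ /= !rmulU /rmul_basis !adjE (negPf pb) (negPf qb) !orbF ?scalerN.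
rewrite [q == p]eq_sym; case: (eqVneq p q) => pq /=; first by rewrite !scaler0 oppr0.
rewrite !scalerA -!exprD !nb_above_adjoin //.
rewrite (_ : adjoin (adjoin b q) p = adjoin (adjoin b p) q); last first.
  by apply: fmonomialP; rewrite /= setUCA.
rewrite -scaleNr; congr (_ *: _).
case: (ltgtP p q) => h; last by rewrite h eqxx in pq.
- by rewrite addn0 addn1 addnS exprS mulN1r addnC.
- by rewrite addn0 addn1 addnS exprS mulN1r opprK addnC.
Qed.

Lemma rmulC p q x : rmul p (rmul q x) = - rmul q (rmul p x).
Proof.
elim/malg_lin_ind: x => [|a b x IH]; first by rewrite !linear0 ?oppr0.
by rewrite !linearP /= IH rmul_basisC ?opprD ?scalerN.
Qed.

Lemma rmul2 p x : rmul p (rmul p x) = 0.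
Proof.
elim/malg_lin_ind: x => [|a b x IH]; first by rewrite !linear0.
rewrite !linearP /= IH addr0 rmulU /rmul_basis.
case: ifP => pb; first by rewrite linear0 scaler0.
rewrite linearZ /= rmulU /rmul_basis ifT ?scaler0 //.
by rewrite in_setE /=; left.
Qed.

Lemma rmul_low x : exists N : int, forall p, p <= N -> rmul p x = 0.
Proof.
elim/malg_lin_ind: x => [|a b x [N IH]]; first by exists 0 => p _; rewrite linear0.
case/asboolP: (occupiedP b) => M bM _; exists (Num.min N M) => p.
rewrite le_min => /andP[pN pM]; rewrite linearP /= IH // addr0 rmulU /rmul_basis.
by rewrite ifT ?scaler0 // in_setE; apply: bM.
Qed.

Lemma e_op_trunc m x : exists N : nat, forall L : nat, (N <= L)%N ->
  e_op m x = \sum_(i < L.*2.+1)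
    rmul (phi (m - (i%:Z - L%:Z))) (rmul (psi (i%:Z - L%:Z)) x).
Proof.
have [N xN] := rmul_low x; exists (`|N| + `|m|)%N => L NL; rewrite /e_op.
pose F i := rmul (phi (m - i)) (rmul (psi i) x).
pose s := [seq i%:Z - L%:Z | i <- iota 0 L.*2.+1].
have sU : uniq s by rewrite map_inj_uniq ?iota_uniq // => i j; lia.
rewrite -(fsbig_widen [set` s] [set: int]) //; last first.
  move=> /= i; move: (i : int) => {}i [_ iNs]; have [iN|iN] := leP (psi i) N.
    by rewrite /= xN // linear0.
  rewrite /= rmulC xN ?linear0 ?oppr0 //; rewrite leNgt; apply/negP => mN.
  apply: iNs; apply/mapP; exists (absz (i + L%:Z)%R); last first.
    by move: iN mN NL; rewrite /psi /phi; lia.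
  by rewrite mem_iota; move: iN mN NL; rewrite /psi /phi; lia.
rewrite -fsbig_seq // big_map -(big_mkord xpredT (fun i => F (i%:Z - L%:Z))).
by rewrite /index_iota subn0.
Qed.

Lemma e_op_is_linear m : linear (e_op m).
Proof.
move=> a x y; have [N1 E1] := e_op_trunc m x; have [N2 E2] := e_op_trunc m y.
have [N3 E3] := e_op_trunc m (a *: x + y); pose L := (N1 + N2 + N3)%N.
rewrite (E1 L) ?(E2 L) ?(E3 L); try by rewrite /L; lia.
rewrite scaler_sumr -big_split /=; apply: eq_bigr => i _.
by rewrite !linearP.
Qed.

HB.instance Definition _ m :=
  GRing.isLinear.Build K fock fock *:%R (e_op m) (e_op_is_linear m).

Lemma rmul_pairC p q r s x : rmul p (rmul q (rmul r (rmul s x))) =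
  rmul r (rmul s (rmul p (rmul q x))).
Proof.
pose f t : {linear fock -> fock} := rmul t.
exact: (@anticomm_pairC K fock f rmulC).
Qed.

Lemma e_opC m l x : e_op m (e_op l x) = e_op l (e_op m x).
Proof.
have [N1 E1] := e_op_trunc l x; have [N2 E2] := e_op_trunc m x.
have [N3 E3] := e_op_trunc m (e_op l x); have [N4 E4] := e_op_trunc l (e_op m x).
pose L := (N1 + N2 + N3 + N4)%N.
rewrite (E3 L) ?(E4 L) ?(E1 L) ?(E2 L); try by rewrite /L; lia.
have lsum t u (h : 'I_(L.*2.+1) -> fock) :
    rmul t (rmul u (\sum_i h i)) = \sum_i rmul t (rmul u (h i)).
  exact: linear_sum2.
transitivity (\sum_(i < L.*2.+1) \sum_(j < L.*2.+1)
    rmul (phi (m - (i%:Z - L%:Z))) (rmul (psi (i%:Z - L%:Z))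
      (rmul (phi (l - (j%:Z - L%:Z))) (rmul (psi (j%:Z - L%:Z)) x)))).
  by apply: eq_bigr => i _; exact: lsum.
rewrite exchange_big /=; apply: eq_bigr => i _; rewrite lsum.
apply: eq_bigr => j _.
exact: rmul_pairC.
Qed.

End Fock.

(* The k-th tensor power of the free module F, with basis the pure tensors of
   basis vectors. *)
Notation fock_tensor K k := {malg K[{ffun 'I_k -> fmonomial}]}.

Section TensorPower.
Variables (K : comNzRingType) (k : nat).
Local Notation fock_tensor := (fock_tensor K k).
Implicit Types (t : {ffun 'I_k -> fmonomial}) (r s : 'I_k) (f g : fock K -> fock K).

Implicit Type w : fock_tensor.

Definition put r t b : {ffun 'I_k -> fmonomial} :=
  [ffun s => if s == r then b else t s].

Definition pure_except r t : fock K -> fock_tensor :=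
  linext (fun b => << put r t b >> : fock_tensor).
HB.instance Definition _ r t := GRing.Linear.on (pure_except r t).

(* Id (x) ... (x) f (x) ... (x) Id with f in position r *)
Definition at_factor r f : fock_tensor -> fock_tensor :=
  linext (fun t => pure_except r t (f << t r >>)).
HB.instance Definition _ r f := GRing.Linear.on (at_factor r f).

Definition e_tensor (m : int) w : fock_tensor :=
  \sum_(r < k) at_factor r (e_op m) w.

Lemma e_tensor_is_linear m : linear (e_tensor m).
Proof.
move=> a x y; rewrite /e_tensor scaler_sumr -big_split /=.
by apply: eq_bigr => r _; rewrite linearP.
Qed.

HB.instance Definition _ m :=
  GRing.isLinear.Build K fock_tensor fock_tensor *:%R (e_tensor m)
    (e_tensor_is_linear m).

Lemma pure_exceptU r t b : pure_except r t << b >> = << put r t b >>.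
Proof. exact: linextU. Qed.

Lemma at_factorU r f t :
  at_factor r f << t >> = pure_except r t (f << t r >>).
Proof. exact: linextU. Qed.

Lemma put_put r t b c : put r (put r t b) c = put r t c.
Proof. by apply/ffunP => s; rewrite !ffunE; case: eqP. Qed.

Lemma putC r s t b c : r != s -> put r (put s t b) c = put s (put r t c) b.
Proof.
move=> rs; apply/ffunP => u; rewrite !ffunE.
by case: (eqVneq u r) => // ->; rewrite (negPf rs).
Qed.

Lemma pure_except0 r t : pure_except r t 0 = 0.
Proof. exact: linear0. Qed.

Lemma pure_exceptP r t a x y :
  pure_except r t (a *: x + y) = a *: pure_except r t x + pure_except r t y.
Proof. exact: linearP. Qed.

Lemma at_factor0 r f : at_factor r f 0 = 0.
Proof. exact: linear0. Qed.

Lemma at_factorP r f a x y :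
  at_factor r f (a *: x + y) = a *: at_factor r f x + at_factor r f y.
Proof. exact: linearP. Qed.

Lemma at_factor_same r (h : {linear fock K -> fock K}) t (x : fock K) :
  at_factor r h (pure_except r t x) = pure_except r t (h x).
Proof.
have idem c (y : fock K) : pure_except r (put r t c) y = pure_except r t y.
  by congr (linext _ y); apply/funext => d; rewrite put_put.
have basis b : at_factor r h (pure_except r t << b >>) = pure_except r t (h << b >>).
  by rewrite pure_exceptU at_factorU ffunE eqxx idem.
elim/malg_lin_ind: x => [|a b x IH].
  by rewrite pure_except0 at_factor0 (linear0 h) pure_except0.
by rewrite pure_exceptP at_factorP IH (linearP h) pure_exceptP basis.
Qed.

Lemma at_factorC_neq r s f g t : r != s ->
  at_factor r f (at_factor s g << t >>) = at_factor s g (at_factor r f << t >>).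
Proof.
have step u v (h : fock K -> fock K) (x : fock K) : v != u ->
    at_factor v h (pure_except u t x) =
    linext (fun b => pure_except v (put u t b) (h << t v >>)) x.
  move=> /negPf vu; have basis b : at_factor v h (pure_except u t << b >>) =
      pure_except v (put u t b) (h << t v >>).
    by rewrite pure_exceptU at_factorU ffunE vu.
  elim/malg_lin_ind: x => [|a b x IH].
    by rewrite pure_except0 at_factor0 linext0.
  by rewrite pure_exceptP at_factorP IH linextP linextU basis.
move=> rs; rewrite !at_factorU !step //; last by rewrite eq_sym.
rewrite /pure_except !linext.unlock.
under eq_bigr => b _ do rewrite scaler_sumr.
under [RHS]eq_bigr => b _ do rewrite scaler_sumr.
rewrite exchange_big /=; apply: eq_bigr => c _; apply: eq_bigr => b _.
by rewrite !scalerA mulrC putC.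
Qed.

Lemma e_tensor0 m : e_tensor m 0 = 0.
Proof. exact: linear0. Qed.

Lemma e_tensorP m a x y :
  e_tensor m (a *: x + y) = a *: e_tensor m x + e_tensor m y.
Proof. exact: linearP. Qed.

Lemma e_tensorC m l w : e_tensor m (e_tensor l w) = e_tensor l (e_tensor m w).
Proof.
have expand m1 m2 t : e_tensor m1 (e_tensor m2 << t >>) =
    \sum_(r < k) \sum_(s < k) at_factor r (e_op m1) (at_factor s (e_op m2) << t >>).
  by apply: eq_bigr => r _; rewrite linear_sum.
have basis t : e_tensor m (e_tensor l << t >>) = e_tensor l (e_tensor m << t >>).
  rewrite !expand exchange_big /=; apply: eq_bigr => r _; apply: eq_bigr => s _.
  have [->|sr] := eqVneq s r; last exact: at_factorC_neq.
  by rewrite !at_factorU !at_factor_same /= e_opC.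
elim/malg_lin_ind: w => [|a t w IH]; first by rewrite !e_tensor0.
by rewrite !e_tensorP IH basis.
Qed.

End TensorPower.

From mathcomp Require Import ssrcomplements mpoly.

(* monalg binds this notation to a different type. *)
Local Notation "{ 'mpoly' T [ n ] }" := (mpoly.mpoly n T) : type_scope.

Section PolynomialAction.
Variables (K : comNzRingType) (n : nat) (V : lmodType K).
Variable T : 'I_n -> {linear V -> V}.
Hypothesis TC : forall i j x, T i (T j x) = T j (T i x).
Implicit Types (m : 'X_{1..n}) (p q : {mpoly K[n]}) (x y : V).

Definition monomial_act m x : V :=
  foldr (fun i => iter (m i) (T i)) x (enum 'I_n).

Definition poly_act p x : V := \sum_(m <- msupp p) p@_m *: monomial_act m x.

Lemma poly_actEw p x d : (msize p <= d)%N ->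
  poly_act p x = \sum_(m : 'X_{1..n < d}) p@_m *: monomial_act m x.
Proof.
move=> pd; rewrite /poly_act (big_mksub 'X_{1..n < d}) ?msupp_uniq //=; first last.
  by move=> m /msize_mdeg_lt /leq_trans; apply.
rewrite big_rmcond //= => m /memN_msupp_eq0 ->.
by rewrite scale0r.
Qed.

Lemma iter_is_linear c i : linear (iter c (T i)).
Proof. by elim: c => [|c IH] a x y //=; rewrite IH linearP. Qed.

Lemma monomial_act_is_linear m : linear (monomial_act m).
Proof.
move=> a x y; rewrite /monomial_act.
by elim: (enum _) => [|i s IH] //=; rewrite IH iter_is_linear.
Qed.

Lemma monomial_actD m x y :
  monomial_act m (x + y) = monomial_act m x + monomial_act m y.
Proof. by rewrite -[x]scale1r monomial_act_is_linear !scale1r. Qed.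

Lemma monomial_act0r m : monomial_act m 0 = 0.
Proof. by apply: (addrI (monomial_act m 0)); rewrite -monomial_actD !addr0. Qed.

Lemma monomial_actZ m a x : monomial_act m (a *: x) = a *: monomial_act m x.
Proof. by rewrite -[a *: x]addr0 monomial_act_is_linear monomial_act0r addr0. Qed.

Lemma iter_actC c i d j x :
  iter c (T i) (iter d (T j) x) = iter d (T j) (iter c (T i) x).
Proof.
have TiC y : T i (iter d (T j) y) = iter d (T j) (T i y).
  by elim: d => //= d IH; rewrite TC IH.
by elim: c => //= c ->; rewrite TiC.
Qed.

Lemma monomial_actM m1 m2 x :
  monomial_act (m1 + m2)%MM x = monomial_act m1 (monomial_act m2 x).
Proof.
rewrite /monomial_act; elim: (enum _) => //= i s ->.
rewrite mnmDE iterD; congr (iter _ _ _).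
move: (foldr _ x s) => y; elim: s => //= j s <-; exact: iter_actC.
Qed.

Lemma monomial_act0 x : monomial_act 0%MM x = x.
Proof. by rewrite /monomial_act; elim: (enum _) => //= i s ->; rewrite mnm0E. Qed.

Lemma poly_actZX c m x : poly_act (c *: 'X_[m]) x = c *: monomial_act m x.
Proof.
rewrite (@poly_actEw _ _ (mdeg m).+1); last first.
  by apply: leq_trans (msizeZ_le _ _) _; rewrite msizeX.
rewrite (bigD1 (BMultinom (ltnSn (mdeg m)))) //= mcoeffZ mcoeffX eqxx mulr1.
rewrite big1 ?addr0 // => m' /eqP m'm; rewrite mcoeffZ mcoeffX.
case: eqP => [e|]; last by rewrite mulr0 scale0r.
by case: m'm; apply: val_inj.
Qed.

Lemma poly_actDl p q x : poly_act (p + q) x = poly_act p x + poly_act q x.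
Proof.
pose d := maxn (msize (p + q)) (maxn (msize p) (msize q)).
rewrite !(@poly_actEw _ _ d) ?leq_max ?leqnn ?orbT //.
by rewrite -big_split; apply: eq_bigr => m _; rewrite mcoeffD scalerDl.
Qed.

Lemma poly_actDr p : {morph poly_act p : x y / x + y}.
Proof.
move=> x y; rewrite /poly_act -big_split; apply: eq_bigr => m _ /=.
by rewrite monomial_actD scalerDr.
Qed.

Lemma poly_act0l x : poly_act 0 x = 0.
Proof. by rewrite /poly_act msupp0 big_nil. Qed.

Lemma poly_act0r p : poly_act p 0 = 0.
Proof. by rewrite /poly_act big1 // => m _; rewrite monomial_act0r scaler0. Qed.

Lemma poly_act1 x : poly_act 1 x = x.
Proof.
have -> : 1 = 1 *: 'X_[0%MM] :> {mpoly K[n]} by rewrite scale1r mpolyX0.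
by rewrite poly_actZX scale1r monomial_act0.
Qed.

Lemma poly_act_monomial c m p x :
  poly_act (c *: 'X_[m] * p) x = poly_act (c *: 'X_[m]) (poly_act p x).
Proof.
elim/mpolyind: p => [|d m' p _ _ IH]; first by rewrite mulr0 !(poly_act0l, poly_act0r).
rewrite mulrDr !poly_actDl poly_actDr IH -scalerAl -scalerAr -mpolyXD scalerA.
by rewrite !poly_actZX monomial_actM monomial_actZ scalerA.
Qed.

Lemma poly_actA p q x : poly_act p (poly_act q x) = poly_act (p * q) x.
Proof.
elim/mpolyind: p => [|c m p _ _ IH]; first by rewrite mul0r !poly_act0l.
by rewrite mulrDl !poly_actDl IH poly_act_monomial.
Qed.

End PolynomialAction.

(* [n] is a phantom argument: it selects the polynomial ring that acts. *)
Definition fock_module (K : comNzRingType) (n k : nat) : Type := fock_tensor K k.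

Section FockModule.
Variables (K : comNzRingType) (n k : nat).
Local Notation fock_module := (fock_module K n k).

HB.instance Definition _ := GRing.Zmodule.copy fock_module (fock_tensor K k).

Definition e_act (p : {mpoly K[n]}) (x : fock_module) : fock_module :=
  poly_act (fun i : 'I_n => e_tensor (i%:Z)) p (x : fock_tensor K k).

Fact e_actA p q x : e_act p (e_act q x) = e_act (p * q) x.
Proof. by apply: poly_actA => i j y; exact: e_tensorC. Qed.

Fact e_act1 : left_id 1 e_act.
Proof. by move=> x; exact: poly_act1. Qed.

Fact e_actDr : right_distributive e_act +%R.
Proof. by move=> p; exact: poly_actDr. Qed.

Fact e_actDl x : {morph e_act^~ x : p q / p + q}.
Proof. by move=> p q; exact: poly_actDl. Qed.

HB.instance Definition _ := GRing.Zmodule_isLmodule.Build {mpoly K[n]}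
  fock_module e_actA e_act1 e_actDr e_actDl.

Lemma e_actX (i : 'I_n) (x : fock_module) : 'X_i *: x = e_tensor (i%:Z) x.
Proof.
have -> : 'X_i = 1 *: 'X_[U_(i)] :> {mpoly K[n]} by rewrite scale1r.
pose T (j : 'I_n) : {linear fock_tensor K k -> fock_tensor K k} :=
  e_tensor (j%:Z).
transitivity (1 *: monomial_act T U_(i)%MM (x : fock_tensor K k)).
  exact: (poly_actZX T).
rewrite scale1r /monomial_act -[RHS]/(T i x).
have out s : i \notin s -> foldr (fun j => iter (U_(i)%MM j) (T j)) x s = x.
  elim: s => //= j s IH; rewrite inE negb_or => /andP[ij /IH ->].
  by rewrite mnm1E (negPf ij).
have : i \in enum 'I_n by rewrite mem_enum.
elim: (enum _) (enum_uniq 'I_n) => //= j s IH /andP[js us].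
rewrite inE mnm1E; case: eqVneq => [ij|ij] /=; last by move/(IH us).
by rewrite out ?ij.
Qed.

End FockModule.

Section CyclicSubmodule.
Variables (P : comNzRingType) (V : lmodType P) (v : V).

Definition in_cyclic : {pred V} := fun w => `[< exists p : P, w = p *: v >].

Fact in_cyclic_submod : submod_closed in_cyclic.
Proof.
split=> [|a x y]; first by apply/asboolP; exists 0; rewrite scale0r.
move=> /asboolP[p ->] /asboolP[q ->]; apply/asboolP; exists (a * p + q).
by rewrite scalerDl scalerA.
Qed.

HB.instance Definition _ := GRing.isSubmodClosed.Build P V in_cyclic in_cyclic_submod.

Definition cyclic_submodule := {w : V | in_cyclic w}.
HB.instance Definition _ := SubChoice.on cyclic_submodule.
HB.instance Definition _ := [SubChoice_isSubLmodule of cyclic_submodule by <:].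

End CyclicSubmodule.

Section ModuleW.
Variables (K : comNzRingType) (n : nat) (A : n.-tuple nat).

Definition e_poly : {poly {mpoly K[n]}} := \sum_(i < n) 'X_i *: 'X^i.

(* [i.+1 - a] is the truncated subtraction (i + 1 - a)_+. *)
Definition JA_gen (g : {mpoly K[n]}) : Prop :=
  exists i m : nat, [/\ (1 <= i)%N, (m < \sum_(a <- A) (i.+1 - a))%N
    & g = (e_poly ^+ i)`_m].

Definition JA : {pred {mpoly K[n]}} := fun p =>
  `[< exists s : seq ({mpoly K[n]} * {mpoly K[n]}),
      (forall c, c \in s -> JA_gen c.2) /\ p = \sum_(c <- s) c.1 * c.2 >].

Lemma JA_gen_meval0 g : JA_gen g -> g.@[fun=> 0] = 0.
Proof.
case=> i [m [i0 _ ->]].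
have e0 : map_poly (meval (fun=> 0)) e_poly = 0.
  rewrite rmorph_sum big1 // => j _.
  by rewrite /= map_polyZ /= mevalXU scale0r.
by rewrite -coef_map rmorphXn /= e0 expr0n gtn_eqF // coef0.
Qed.

Fact JA_idealr : idealr_closed JA.
Proof.
split.
- by apply/asboolP; exists [::]; rewrite big_nil.
- apply/negP => /asboolP[s [sJ]] /(congr1 (meval (fun=> 0))).
  rewrite rmorph1 rmorph_sum big_seq big1; first by move/eqP; rewrite oner_eq0.
  by move=> c cs; rewrite rmorphM /= (JA_gen_meval0 (sJ c cs)) mulr0.
move=> a p q /asboolP[s [sJ ->]] /asboolP[t [tJ ->]]; apply/asboolP.
exists ([seq (a * c.1, c.2) | c <- s] ++ t); split.
  by move=> c; rewrite mem_cat => /orP[/mapP[d ds ->]|]; [exact: (sJ d)|exact: tJ].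
rewrite big_cat big_map mulr_sumr; congr (_ + _).
by apply: eq_bigr => c _; rewrite mulrA.
Qed.

HB.instance Definition _ := isIdealr.Build {mpoly K[n]} JA JA_idealr.

Definition WA := {ideal_quot JA}.
HB.instance Definition _ := GRing.Zmodule.copy WA {ideal_quot JA}.

Definition WA_scale (p : {mpoly K[n]}) (x : WA) : WA :=
  (\pi_{ideal_quot JA} p)%qT * (x : {ideal_quot JA}).

Fact WA_scaleA p q x : WA_scale p (WA_scale q x) = WA_scale (p * q) x.
Proof. by rewrite /WA_scale rmorphM mulrA. Qed.

Fact WA_scale1 : left_id 1 WA_scale.
Proof. by move=> x; rewrite /WA_scale rmorph1 mul1r. Qed.

Fact WA_scaleDr : right_distributive WA_scale +%R.
Proof. by move=> p x y; rewrite /WA_scale mulrDr. Qed.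

Fact WA_scaleDl x : {morph WA_scale^~ x : p q / p + q}.
Proof. by move=> p q; rewrite /WA_scale rmorphD mulrDl. Qed.

HB.instance Definition _ := GRing.Zmodule_isLmodule.Build {mpoly K[n]} WA
  WA_scaleA WA_scale1 WA_scaleDr WA_scaleDl.

Fact vacuum_subproof (c : int) : `[< semi_infinite [set p : int | p <= c] >].
Proof.
apply/asboolP; exists c => //=; rewrite (_ : _ `&` _ = set0) //.
by apply/seteqP; split=> p //= -[/= pc /lt_geF]; rewrite pc.
Qed.

(* The vector v(c): by the numbering of the fermions, v(2N) ends with psi(N) and
   v(2N+1) ends with phi(N). *)
Definition vacuum (c : int) : fmonomial := FMonomial (vacuum_subproof c).

Definition mult_in_A (j : nat) : nat := count_mem j A.

(* The factor of index r : 'I_k is v(-1 + d_1 + ... + d_{r+1}). *)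
Definition vA (k : nat) : fock_module K n k :=
  << [ffun r : 'I_k => vacuum (-1 + (\sum_(1 <= j < r.+2) mult_in_A j)%:Z)] >>.

Definition WA_fock (k : nat) := cyclic_submodule (vA k).
HB.instance Definition _ k := GRing.Lmodule.on (WA_fock k).

End ModuleW.

(* Main.v *)
From HB Require Import structures.
Require Import Defs.
From mathcomp Require Import all_boot all_order all_algebra.
From mathcomp Require Import complex.
From mathcomp Require Import boolp classical_sets cardinality fsbigop.
From mathcomp Require Import reals monalg.
From mathcomp Require Import zify ring.
From mathcomp Require Import ssrcomplements mpoly.

(** Write D_r = d_1 + ... + d_r, so that v_A is the tensor product of the vacuum
vectors v(D_r - 1).  The statement concerns only these levels: put
N(m) = #{r : D_r <= m} and S(i) = sum_(m < n) (i - N(m))_+.  For sorted A with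
largest entry k + 1 the (m+1)-st entry is N(m) + 1, hence
S(i) = sum_j (i + 1 - a_j)_+.  Let v_D be the vacuum tensor of an arbitrary family
of levels D, let e(z) be the polynomial with coefficients e_0, ..., e_(n-1), and let
J(D) be the ideal generated by the coefficients of z^m, m < S(i), in e(z)^i.  The
annihilator of v_D is exactly J(D) ([fusion_ideal_kills],
[annihilator_fusion_ideal]), and the isomorphism sends the class of P to P v_A.

The relations hold.  In one factor the complete series t(z) of modes satisfies
t(z)^2 = 0, because psi(z) is odd, and on v(D - 1) it is divisible by z^D.  The
truncated series is t(z) - z^n w(z), so its a-th power is divisible by z to the
exponent sum_(m < n) (a - [D <= m])_+, which is D + (a - 1) n when D <= n and 0 < a.
The binomial formula adds these exponents over the factors.

The relations suffice.  Induct downwards on the smallest level s, then on the number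
p > 0 of factors of level s; if s >= n every e_i lies in J(D).  A trivial factor, killed by
all e_i, may be adjoined, so some level is >= s + 2; let r1 be a smallest one.
- [annihilator_exchange]: an operator quadratic in the fermions, which commutes with
  every e_m, moves one fermion from the factor r1 to a factor of level s.  It turns
  v_D into v_D', where one level s becomes s + 1 and the level of r1 drops by one.
  So Ann(v_D) is contained in Ann(v_D') = J(D').
- [fusion_ideal_exchange]: J(D') is contained in J(D) + (e_s^p), since a product of i
  modes of index at least s and total index si + (i - p) contains e_s at least p times.
- [e_pow_vacuum_tensor]: e_s^p v_D is a nonzero multiple of v_D'', in which every
  level s has become s + 2.  So if e_s^p Q kills v_D, then Q lies in
  Ann(v_D'') = J(D'').
- [fusion_ideal_raise]: e_s^p J(D'') is contained in J(D).
Together, P in Ann(v_D) is congruent modulo J(D) to some e_s^p Q that kills v_D,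
and such a product lies in J(D).

The last inclusion rests on [vanish_mul_lowest].  If f starts with f_s z^s, then
(s + 1) f - z f' - f_s z^s is divisible by z^(s+2), while f' f^l is a multiple of the
derivative of f^(l+1).  So a bound on the orders of f^l and f^(l+1) gives one for
f_s f^l. *)

Set Implicit Arguments.
Unset Strict Implicit.
Unset Printing Implicit Defensive.

Import Order.TTheory GRing.Theory Num.Theory.

Local Open Scope ring_scope.

Local Notation "{ 'mpoly' T [ n ] }" := (mpoly.mpoly n T) : type_scope.

(** * Ideals and orders of vanishing *)

Inductive ideal_span (B : comNzRingType) (G : B -> Prop) : B -> Prop :=
| IdealSpan0 : ideal_span G 0
| IdealSpanMD a g x : G g -> ideal_span G x -> ideal_span G (a * g + x).

Definition is_ideal (B : comNzRingType) (I : B -> Prop) : Prop :=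
  [/\ I 0, forall x y, I x -> I y -> I (x + y) & forall a x, I x -> I (a * x)].

Section Ideals.
Variable B : comNzRingType.
Implicit Types (G I : B -> Prop) (a b x y : B).

Lemma ideal_span_min G I x :
  is_ideal I -> (forall g, G g -> I g) -> ideal_span G x -> I x.
Proof.
by case=> I0 ID IM GI; elim=> // a g y /GI Gg _ Iy; apply: ID => //; apply: IM.
Qed.

Lemma ideal_span_gen G g : G g -> ideal_span G g.
Proof. by move=> Gg; rewrite -[g]addr0 -[g]mul1r; do !constructor. Qed.

Lemma ideal_span_ideal G : is_ideal (ideal_span G).
Proof.
split; first exact: IdealSpan0.
  by move=> x y; elim=> [|a g z Gg _ IH] Gy; rewrite ?add0r // -addrA; constructor; auto.
move=> a x; elim=> [|b g z Gg _ IH]; first by rewrite mulr0; constructor.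
by rewrite mulrDr mulrA; constructor.
Qed.

(** With this the inclusion b J' <= I needs checking on generators of J' only. *)
Lemma ideal_colon I b : is_ideal I -> is_ideal (fun x => I (b * x)).
Proof.
case=> I0 ID IM; split=> [|x y Ix Iy|a x Ix]; first by rewrite mulr0.
  by rewrite mulrDr; apply: ID.
by rewrite mulrCA; apply: IM.
Qed.

Lemma ideal_add_principal I b :
  is_ideal I -> is_ideal (fun x => exists q, I (x - b * q)).
Proof.
case=> I0 ID IM; split=> [|x y [q Iq] [r Ir]|a x [q Iq]].
- by exists 0; rewrite mulr0 subrr.
- by exists (q + r); rewrite mulrDr opprD addrACA; apply: ID.
- by exists (a * q); rewrite mulrCA -mulrBr; apply: IM.
Qed.

End Ideals.

(** Order of vanishing modulo I: f is congruent to a multiple of z^T. *)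
Definition vanish (B : comNzRingType) (I : B -> Prop) (T : nat) (f : {poly B}) : Prop :=
  forall m, (m < T)%N -> I f`_m.

Section VanishingOrder.
Variables (B : comNzRingType) (I : B -> Prop).
Hypothesis II : is_ideal I.
Implicit Types (f g h : {poly B}) (T U : nat) (w : nat -> nat).

Let I0 : I 0. Proof. by case: II. Qed.
Let ID x y : I x -> I y -> I (x + y). Proof. by case: II => _ + _; apply. Qed.
Let IM a x : I x -> I (a * x). Proof. by case: II => _ _; apply. Qed.

Lemma ideal_sum (J : Type) (r : seq J) (P : pred J) (F : J -> B) :
  (forall j, P j -> I (F j)) -> I (\sum_(j <- r | P j) F j).
Proof. by move=> FI; elim/big_ind: _. Qed.

Lemma vanishW T U f : (U <= T)%N -> vanish I T f -> vanish I U f.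
Proof. by move=> UT fT m mU; apply: fT; apply: leq_trans UT. Qed.

Lemma vanishD T f g : vanish I T f -> vanish I T g -> vanish I T (f + g).
Proof. by move=> fT gT m mT; rewrite coefD; apply: ID; [apply: fT|apply: gT]. Qed.

Lemma vanish_sum T (J : Type) (r : seq J) (P : pred J) (F : J -> {poly B}) :
  (forall j, P j -> vanish I T (F j)) -> vanish I T (\sum_(j <- r | P j) F j).
Proof. by move=> FT m mT; rewrite coef_sum; apply: ideal_sum => j /FT; apply. Qed.

Lemma vanishM T U f g : vanish I T f -> vanish I U g -> vanish I (T + U) (f * g).
Proof.
move=> fT gU m mTU; rewrite coefM; apply: ideal_sum => j _.
have [jT|Tj] := ltnP j T; first by rewrite mulrC; apply/IM/fT.
by apply/IM/gU; have := ltn_ord j; lia.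
Qed.

Lemma vanish_mull T f g : vanish I T g -> vanish I T (f * g).
Proof. by move=> gT; rewrite -[T]add0n; apply: vanishM. Qed.

Lemma vanishN T f : vanish I T f -> vanish I T (- f).
Proof. by move=> fT; rewrite -mulN1r; apply: vanish_mull. Qed.

Lemma vanishMn T f d : vanish I T f -> vanish I T (f *+ d).
Proof. by move=> fT; rewrite -mulr_natl; apply: vanish_mull. Qed.

Lemma vanishX T f i : vanish I T f -> vanish I (T * i) (f ^+ i).
Proof.
by move=> fT; elim: i => [|i IH]; rewrite ?muln0 // mulnS exprS; apply: vanishM.
Qed.

Lemma vanishXn T : vanish I T 'X^T.
Proof. by move=> m mT; rewrite coefXn ltn_eqF. Qed.

Lemma vanish_mulXn s T f : vanish I T ('X^s * f) -> vanish I (T - s) f.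
Proof.
move=> fT m mT; have := fT (m + s)%N.
by rewrite coefXnM ifF ?addnK; [apply; lia|lia].
Qed.

Lemma vanish_deriv T f : vanish I T f -> vanish I T ('X * f^`()).
Proof.
move=> fT [|m] mT; rewrite coefXM //= coef_deriv -mulr_natl.
by apply/IM/fT.
Qed.

(** In (f_s z^s + h)^i, where h vanishes to order s + 1, a term with q < p factors
f_s z^s has order at least s i + (i - q) > s i + (i - p); the other terms are multiples
of f_s^p. *)
Lemma vanish_pow_lowest s p f i :
  vanish I s f -> I (f`_s ^+ p) -> (p <= i)%N -> vanish I (s * i + (i - p).+1) (f ^+ i).
Proof.
move=> fs fp pi; pose h := f - f`_s *: 'X^s.
have hs : vanish I s.+1 h.
  move=> m; rewrite ltnS leq_eqVlt coefB coefZ coefXn => /orP[/eqP->|ms].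
    by rewrite eqxx mulr1 subrr.
  by rewrite ltn_eqF // mulr0 subr0; apply: fs.
rewrite -[f](subrK (f`_s *: 'X^s)) -/h exprDn; apply: vanish_sum => q _.
apply: vanishMn; rewrite exprZn.
have [pq|qp] := leqP p q.
  have -> : f`_s ^+ q = f`_s ^+ (q - p) * f`_s ^+ p by rewrite -exprD subnK.
  by move=> m _; rewrite -scalerAr coefZ mulrAC; apply: IM.
rewrite -scalerAr -mul_polyC; apply: vanish_mull.
apply: (@vanishW (s.+1 * (i - q) + s * q)); first by have := ltn_ord q; nia.
by apply: vanishM; rewrite -?exprM; [apply: vanishX|apply: vanishXn].
Qed.

Hypothesis I_div : forall (d : nat) x, I (x *+ d.+1) -> I x.

(** The combination (s + 1) f - z f' cancels the coefficient of z^(s+1), so up to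
order s + 2 it is f_s z^s; multiplied by c f^l, its two summands are controlled by the
order of c f^(l+1), the second one because c f' f^l is the derivative of c f^(l+1)
divided by l + 1. *)
Lemma vanish_mul_lowest s c f w :
    vanish I s f -> (forall l, vanish I (w l) (c%:P * f ^+ l)) ->
  forall l, vanish I (minn (w l.+1 - s) (w l).+2) ((c * f`_s)%:P * f ^+ l).
Proof.
move=> fs fw l; pose g := s.+1%:R * f - 'X * f^`() - f`_s *: 'X^s.
(* the coefficient of z^j in (s + 1) f - z f' is (s + 1 - j) f_j *)
have gs : vanish I s.+2 g.
  move=> m; rewrite !coefB mulr_natl coefMn coefZ coefXn coefXM coef_deriv.
  move=> ms; case: m => [|m] /= in ms *.
    case: (posnP s) => [->|s0]; first by rewrite mulr1 subr0 subrr.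
    rewrite eq_sym (gtn_eqF s0) mulr0 !subr0 -mulr_natl.
    by apply/IM/fs.
  case: (ltngtP m.+1 s) => ms'.
  - rewrite mulr0 subr0 -mulrnBr; last by lia.
    by rewrite -mulr_natl; apply/IM/fs.
  - have -> : m = s by lia.
    by rewrite subrr mulr0 subr0.
  - by rewrite -ms' mulr1 -mulrnBr // subSnn subrr.
have [ws|sw] := leqP (w l.+1) s.
  by move=> m; rewrite (eqP (ws : (_ - _ == 0)%N)) min0n.
rewrite -[minn _ _](addnK s); apply: vanish_mulXn.
have -> : 'X^s * ((c * f`_s)%:P * f ^+ l) =
    s.+1%:R * (c%:P * f ^+ l.+1) + - ('X * (c%:P * f^`() * f ^+ l)) + - (g * (c%:P * f ^+ l)).
  rewrite /g -mul_polyC polyCM exprS; ring.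
apply: vanishD; last first.
  apply: vanishN; apply: vanishW (vanishM gs (fw l)); lia.
apply: vanishD; first by apply: vanishW (vanish_mull _ (fw l.+1)); lia.
apply: vanishN; have := vanish_deriv (fw l.+1).
rewrite derivM derivC mul0r add0r deriv_exp /= -!mulrnAr.
move=> h m mT; apply: (@I_div l); rewrite -coefMn.
have -> : ('X * (c%:P * f^`() * f ^+ l)) *+ l.+1 = 'X * (c%:P * (f^`() * (f ^+ l *+ l.+1))).
  by rewrite -!mulrA -!mulrnAr.
by apply: h; lia.
Qed.

(** Iteration of the previous bound: each of the p steps either passes from f^l to
f^(l+1) at the cost of s or gains 2, and the hypothesis takes all choices into
account. *)
Lemma vanish_lowest_pow s f w p l U :
    vanish I s f -> (forall l, vanish I (w l) (f ^+ l)) ->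
    (forall q, (q <= p)%N -> (U + s * q <= w (l + q) + 2 * (p - q))%N) ->
  vanish I U ((f`_s ^+ p)%:P * f ^+ l).
Proof.
move=> fs fw; rewrite -[f`_s ^+ p]mul1r.
have {fw} : forall l, vanish I (w l) (1%:P * f ^+ l) by move=> m; rewrite mul1r.
elim: p 1 w U => [|p IH] c w U fw Uw.
  rewrite expr0 mulr1; apply: vanishW (fw l).
  by have := Uw 0%N (leqnn _); rewrite addn0; lia.
rewrite exprS mulrA; apply: IH (vanish_mul_lowest fs fw) _ => q qp.
have := Uw q (leqW qp); have := Uw q.+1 qp; rewrite addnS mulnS; lia.
Qed.

End VanishingOrder.

Lemma sum_ltn_ord n d : (\sum_(m < n) (m < d)%N = minn n d)%N.
Proof.
elim: n => [|n IH]; first by rewrite big_ord0 min0n.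
by rewrite big_ord_recr /= IH; case: (ltnP n d); lia.
Qed.

Section VanishingPowers.
Variables (B : comNzRingType) (I : B -> Prop).
Hypothesis II : is_ideal I.

(** Expand (f - z^n w)^a: since f^2 vanishes to order M, only the terms of degree 0
and 1 in f matter, of order n a and d + n (a - 1). *)
Lemma vanish_truncated_pow (f w : {poly B}) (d n M a : nat) :
    vanish I d f -> vanish I M (f ^+ 2) -> (n * a <= M)%N ->
  vanish I (\sum_(m < n) (a - (d <= m)%N))%N ((f - 'X^n * w) ^+ a).
Proof.
move=> fd f2 naM; set T := (\sum_(m < n) _)%N.
have Tna : (T <= n * a)%N.
  rewrite -[n in X in (_ <= X)%N]card_ord -sum_nat_const; apply: leq_sum => m _; lia.
have wb b : vanish I (n * b) ((- ('X^n * w)) ^+ b).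
  apply: (vanishX II); apply: (vanishN II); rewrite mulrC.
  by apply: (vanish_mull II); apply: (vanishXn II).
rewrite exprDn; apply: (vanish_sum II) => b _; apply: (vanishMn II).
have := ltn_ord b; rewrite ltnS => ba.
case e : (a - b)%N => [|[|c]].
- rewrite expr0 mul1r; apply: vanishW (wb b); have -> : nat_of_ord b = a by lia.
  exact: Tna.
- rewrite expr1; apply: vanishW (vanishM II fd (wb b)).
  have -> : nat_of_ord b = a.-1 by lia.
  apply: (@leq_trans (\sum_(m < n) ((m < d) + a.-1))%N).
    by apply: leq_sum => m _; lia.
  rewrite big_split /= sum_ltn_ord sum_nat_const card_ord; lia.
- rewrite -addn2 exprD -mulrA mulrC -mulrA; apply: (vanishW _ (vanishM II f2 (_ : vanish I 0 _))) => //.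
  by rewrite addn0; lia.
Qed.

(** In the binomial expansion the bounds add up termwise in m:
(a - x)_+ + (b - y)_+ >= (a + b - x - y)_+. *)
Lemma vanish_sum_pow (J : Type) (r : seq J) (u : J -> {poly B}) (n i : nat)
    (eps : J -> nat -> nat) :
    (forall j a, (a <= i)%N -> vanish I (\sum_(m < n) (a - eps j m))%N (u j ^+ a)) ->
  vanish I (\sum_(m < n) (i - \sum_(j <- r) eps j m))%N ((\sum_(j <- r) u j) ^+ i).
Proof.
move=> uV; suff gen a : (a <= i)%N ->
  vanish I (\sum_(m < n) (a - \sum_(j <- r) eps j m))%N ((\sum_(j <- r) u j) ^+ a).
  exact: gen.
elim: r a => [|j r IH] a ai.
  rewrite big_nil; case: a ai => [|a] _; last by rewrite expr0n => m _; rewrite coef0; case: II.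
  by rewrite big1 // => m _; rewrite sub0n.
rewrite big_cons exprDn; apply: (vanish_sum II) => b _; apply: (vanishMn II).
have := ltn_ord b; rewrite ltnS => ba.
apply: vanishW (vanishM II (uV j (a - b)%N _) (IH b _)); try lia.
rewrite -big_split; apply: leq_sum => m _; rewrite big_cons /=; lia.
Qed.

End VanishingPowers.

(** * Finite sums over the integers *)

Definition int_box (L : nat) : seq int := [seq i%:Z - L%:Z | i <- iota 0 L.*2.+1].

Lemma mem_int_box L i : (i \in int_box L) = (`|i| <= L)%N.
Proof.
apply/mapP/idP => [[j]|iL]; first by rewrite mem_iota => ? ->; lia.
by exists (absz (i + L%:Z)%R); rewrite ?mem_iota; lia.
Qed.

Lemma int_box_uniq L : uniq (int_box L).
Proof. by rewrite map_inj_uniq ?iota_uniq // => i j; lia. Qed.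

Lemma fsbig_support (V : zmodType) (G : int -> V) (s : seq int) :
  uniq s -> (forall i, i \notin s -> G i = 0) ->
  \sum_(i \in [set: int]) G i = \sum_(i <- s) G i.
Proof.
move=> sU Gs; rewrite -(fsbig_widen [set` s] [set: int]) //; first by rewrite -fsbig_seq.
by move=> i [_ /negP/Gs].
Qed.

Lemma sum_reflect (V : zmodType) (G : int -> V) (c : int) (s : seq int) :
    uniq s -> (forall i, G i != 0 -> (i \in s) && (c - i \in s)) ->
  \sum_(i <- s) G (c - i) = \sum_(i <- s) G i.
Proof.
move=> sU Gs; rewrite -(@fsbig_support V (fun i => G (c - i)) s) //; last first.
  by move=> i; apply: contraNeq => /Gs /andP[_]; rewrite opprB addrC subrK.
rewrite -(@fsbig_support V G s) //; last by move=> i; apply: contraNeq => /Gs /andP[].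
rewrite [RHS](reindex_fsbigT (fun i => c - i)) //.
by exists (fun i => c - i) => i; lia.
Qed.

Lemma sum_reflectB (V : zmodType) (G : int -> V) (c : int) (s : seq int) :
    uniq s -> (forall i, G i != 0 -> (i \in s) && (c - i \in s)) ->
  \sum_(i <- s) (G (c - i) - G i) = 0.
Proof. by move=> sU Gs; rewrite sumrB sum_reflect ?subrr. Qed.

Fact remove_subproof (b : fmonomial) (p : int) : `[< semi_infinite (b `\ p) >].
Proof.
case/asboolP: (occupiedP b) => N bN _; apply/asboolP; exists (Num.min N (p - 1)).
  by move=> q; rewrite le_min => /andP[qN qp]; split; [apply: bN|move=> /= ?; lia].
apply: sub_finite_set (semi_infinite_above b (Num.min N (p - 1))).
by move=> q [[]].
Qed.

Definition remove (b : fmonomial) (p : int) : fmonomial :=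
  FMonomial (remove_subproof b p).

Section FockOperators.
Variable K : comNzRingType.
Local Notation fock := (fock K).
Implicit Types (b : fmonomial) (p q a c : int) (x y : fock).

Lemma adjoin_remove b p : p \in (b : set int) -> adjoin (remove b p) p = b.
Proof. by rewrite in_setE => bp; apply: fmonomialP; rewrite /= setD1K. Qed.

Lemma remove_adjoin b p : p \notin (b : set int) -> remove (adjoin b p) p = b.
Proof.
rewrite notin_setE => bp; apply: fmonomialP => /=; apply/seteqP; split=> q /=.
  by case=> -[].
by move=> bq; split; [right|move=> qp; apply: bp; rewrite -qp].
Qed.

Lemma mem_adjoin b p q : (q \in (adjoin b p : set int)) = (q == p) || (q \in (b : set int)).
Proof.
apply/idP/orP; first by rewrite in_setE => -[->|?]; [left|right; rewrite in_setE].
by case=> [/eqP->|]; rewrite !in_setE; [left|right].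
Qed.

Lemma mem_remove b p q : (q \in (remove b p : set int)) = (q != p) && (q \in (b : set int)).
Proof.
apply/idP/andP; first by rewrite in_setE => -[bq /eqP qp]; split=> //; rewrite in_setE.
by case=> /eqP qp; rewrite !in_setE.
Qed.

Lemma adjoinC b p q : adjoin (adjoin b p) q = adjoin (adjoin b q) p.
Proof. by apply: fmonomialP; rewrite /= setUCA. Qed.

(** The adjoint of right multiplication by the fermion p: bring p to the right end
of the monomial, then delete it. *)
Definition contract_basis (p : int) b : fock :=
  if p \in (b : set int) then (-1) ^+ nb_above b p *: << remove b p >> else 0.

Definition contract (p : int) : fock -> fock := linext (contract_basis p).
HB.instance Definition _ p := GRing.Linear.on (contract p).

Lemma contractU p b : contract p << b >> = contract_basis p b.
Proof. exact: linextU. Qed.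

Lemma signr_sq d : (-1) ^+ d * (-1) ^+ d = 1 :> K.
Proof. by rewrite -expr2 sqrr_sign. Qed.

(** The canonical anticommutation relations. *)
Lemma contract_rmul p q x :
  contract p (rmul q x) = (if p == q then x else 0) - rmul q (contract p x).
Proof.
elim/malg_lin_ind: x => [|t b x IH].
  by rewrite !linear0 if_same add0r.
have -> : (if p == q then t *: << b >> + x else 0) =
    t *: (if p == q then << b >> else 0) + (if p == q then x else 0).
  by case: ifP; rewrite ?scaler0 ?addr0.
rewrite !linearP /= {}IH addrACA -scalerDr; congr (t *: _ + _).
rewrite rmulU contractU /rmul_basis /contract_basis.
have [bq|bq] := boolP (q \in (b : set int)).
  rewrite linear0; case: (eqVneq p q) => [->|pq].
    rewrite bq linearZ /= rmulU /rmul_basis mem_remove eqxx /= scalerA.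
    rewrite -{2}(adjoin_remove bq) nb_above_adjoin ?mem_remove ?eqxx //.
    by rewrite ltxx addn0 signr_sq scale1r adjoin_remove // subrr.
  case: ifP => _; last by rewrite linear0 subr0.
  by rewrite linearZ /= rmulU /rmul_basis mem_remove eq_sym pq bq scaler0 subr0.
rewrite linearZ /= contractU /contract_basis mem_adjoin.
have [->|pq] /= := eqVneq p q.
  rewrite (negPf bq) linear0 subr0 scalerA nb_above_adjoin // ltxx addn0.
  by rewrite signr_sq scale1r remove_adjoin.
case: ifP => bp; last by rewrite scaler0 linear0 subr0.
rewrite [rmul q _]linearZ /= rmulU /rmul_basis mem_remove (negPf bq) andbF sub0r.
set d := remove b p; have dp : p \notin (d : set int) by rewrite mem_remove eqxx.
have dq : q \notin (d : set int) by rewrite mem_remove (negPf bq) andbF.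
have dqp : p \notin (adjoin d q : set int) by rewrite mem_adjoin negb_or pq.
rewrite -[in LHS](adjoin_remove bp) -/d adjoinC remove_adjoin //.
rewrite -[in RHS](adjoin_remove bp) -/d !nb_above_adjoin // ltxx addn0.
rewrite !scalerA -scaleNr; congr (_ *: _); rewrite -!exprD -[- (_ ^+ _)]mulN1r -exprS.
by case: (ltgtP p q) pq => // pq _; rewrite ?addn0 ?addn1 //; congr (_ ^+ _); lia.
Qed.

End FockOperators.

Section FockCurrent.
Variable K : comNzRingType.
Local Notation fock := (fock K).
Implicit Types (b : fmonomial) (p q a c : int) (x y : fock).

Lemma e_op_seq (s : seq int) a x : uniq s ->
  (forall i, i \notin s -> rmul (phi (a - i)) (rmul (psi i) x) = 0) ->
  e_op a x = \sum_(i <- s) rmul (phi (a - i)) (rmul (psi i) x).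
Proof.
exact: (@fsbig_support fock (fun i => rmul (phi (a - i)) (rmul (psi i) x)) s).
Qed.

Lemma e_op_box a x : exists N, forall L, (N <= L)%N ->
  e_op a x = \sum_(i <- int_box L) rmul (phi (a - i)) (rmul (psi i) x).
Proof.
have [N xN] := e_op_trunc a x; exists N => L /xN ->.
pose F i := rmul (phi (a - i)) (rmul (psi i) x).
rewrite big_map -(big_mkord xpredT (fun i => F (i%:Z - L%:Z))).
by rewrite /index_iota subn0.
Qed.

Lemma fermionP p : (exists i, p = psi i) \/ (exists j, p = phi j).
Proof.
rewrite /psi /phi; have [o|o] := boolP (odd `|p|).
  by right; exists ((p - 1) %/ 2)%Z; lia.
by left; exists (p %/ 2)%Z; lia.
Qed.

Lemma sum_delta_seq (V : zmodType) (s : seq int) (i : int) (y : V) :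
  uniq s -> i \in s -> \sum_(j <- s) (if j == i then y else 0) = y.
Proof.
by move=> sU si; rewrite (bigD1_seq i) //= eqxx big1 ?addr0 // => j /negPf ->.
Qed.

Lemma rmul_e_op p a x : rmul p (e_op a x) = e_op a (rmul p x).
Proof.
have [N1 E1] := e_op_box a x; have [N2 E2] := e_op_box a (rmul p x).
rewrite (E1 (N1 + N2)%N) ?(E2 (N1 + N2)%N); try lia.
rewrite linear_sum; apply: eq_bigr => i _ /=.
by rewrite rmulC [rmul p (rmul (psi i) x)]rmulC linearN opprK.
Qed.

(** The coefficient e_a pairs the fermions p and 2 a + 1 - p, whatever the parity of
p; contracting p leaves its partner, with a sign because psi stands before phi. *)
Lemma contract_e_op p a x :
  contract p (e_op a x) = e_op a (contract p x) - (-1) ^+ `|p|%N *: rmul (2 * a + 1 - p) x.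
Proof.
have [N1 E1] := e_op_box a x; have [N2 E2] := e_op_box a (contract p x).
pose L := (N1 + N2 + `|p| + `|a|)%N.
rewrite (E1 L) ?(E2 L); try by rewrite /L; lia.
have [i0 [i0L term]] : exists i0 : int, i0 \in int_box L /\ forall i,
    contract p (rmul (phi (a - i)) (rmul (psi i) x)) =
    rmul (phi (a - i)) (rmul (psi i) (contract p x)) +
    (if i == i0 then - ((-1) ^+ `|p|%N *: rmul (2 * a + 1 - p) x) else 0).
  case: (fermionP p) => -[j pj].
    exists j; split; first by rewrite mem_int_box /L pj /psi; lia.
    move=> i; rewrite pj !contract_rmul ifF; last by rewrite /psi /phi; lia.
    rewrite (_ : (psi j == psi i) = (i == j)); last by rewrite /psi; lia.
    rewrite sub0r linearB opprB /=; congr (_ + _).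
    case: eqVneq => [->|_]; last by rewrite linear0 oppr0.
    rewrite -signr_odd (_ : odd _ = false) ?scale1r; last by rewrite /psi; lia.
    by congr (- rmul _ _); rewrite /psi /phi; lia.
  exists (a - j); split; first by rewrite mem_int_box /L pj /phi; lia.
  move=> i; rewrite pj !contract_rmul [X in _ - rmul _ (X - _)]ifF; last by rewrite /psi /phi; lia.
  rewrite (_ : (phi j == phi (a - i)) = (i == a - j)); last by rewrite /phi; lia.
  rewrite sub0r linearN opprK addrC; congr (_ + _).
  case: eqVneq => // ->.
  rewrite -signr_odd (_ : odd _ = true) /= ?expr1 ?scaleN1r ?opprK; last by rewrite /phi; lia.
  by congr (rmul _ _); rewrite /psi /phi; lia.
rewrite linear_sum /= (eq_bigr _ (fun i _ => term i)) big_split /=; congr (_ + _).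
by rewrite sum_delta_seq ?int_box_uniq.
Qed.

(** The vectors of the form (vacuum up to c) times fermions: every fermion up to c is
already present.  This space is stable under the e_a, and on it their defining sums
become explicit finite sums. *)
Definition killed_upto c x : Prop := forall p, p <= c -> rmul p x = 0.

Lemma vacuum_killed_upto c : killed_upto c << vacuum c >>.
Proof. by move=> p pc; rewrite rmulU /rmul_basis ifT // in_setE. Qed.

Lemma e_op_killed_upto c a x : killed_upto c x -> killed_upto c (e_op a x).
Proof. by move=> xc p pc; rewrite rmul_e_op xc // linear0. Qed.

(** One of the partners p and 2 a + 1 - p is at most c as soon as a <= c. *)
Lemma e_op_eq0 c a x : killed_upto c x -> a <= c -> e_op a x = 0.
Proof.
move=> xc ac; rewrite (@e_op_seq [::]) ?big_nil // => i _.
have [ic|ci] := leP (psi i) c; first by rewrite xc // linear0.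
by rewrite rmulC xc ?linear0 ?oppr0 //; move: ci; rewrite /psi /phi; lia.
Qed.

Lemma e_op_finite_sum (M : nat) a x : killed_upto (-1) x -> a <= M%:Z ->
  e_op a x = \sum_(i < M.+1) rmul (phi (a - i%:Z)) (rmul (psi i%:Z) x).
Proof.
move=> xc aM; pose F i := rmul (phi (a - i)) (rmul (psi i) x).
have sU : uniq [seq i%:Z | i <- iota 0 M.+1].
  by rewrite map_inj_uniq ?iota_uniq // => i j; lia.
rewrite (e_op_seq sU); last first.
  move=> i /mapP iM; have [ic|ci] := ltP i 0; first by rewrite xc ?linear0 // /psi; lia.
  rewrite rmulC xc ?linear0 ?oppr0 // leNgt; apply/negP => ai; apply: iM.
  by exists `|i|%N; [rewrite mem_iota; move: ai; rewrite /phi|]; lia.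
by rewrite big_map -(big_mkord xpredT (fun i => F i%:Z)) /index_iota subn0.
Qed.

Lemma vacuum_adjoin c : adjoin (vacuum c) (c + 1) = vacuum (c + 1).
Proof.
apply: fmonomialP; apply/seteqP; split=> p /=; first by case=> [->|] //; lia.
by move=> ?; case: (eqVneq p (c + 1)) => [->|]; [left|right; lia].
Qed.

Lemma rmul_vacuum c : rmul (c + 1) << vacuum c >> = << vacuum (c + 1) >> :> fock.
Proof.
rewrite rmulU /rmul_basis ifF; last by apply/negbTE; rewrite notin_setE /=; lia.
rewrite vacuum_adjoin /nb_above (_ : (_ `&` _)%classic = set0) ?fset_set0 ?cardfs0 ?scale1r //.
by apply/seteqP; split=> p //= -[]; rewrite /=; lia.
Qed.

Lemma contract_vacuum c : contract c << vacuum c >> = << vacuum (c - 1) >> :> fock.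
Proof.
have e : c = c - 1 + 1 by lia.
rewrite {1 2}e -rmul_vacuum contract_rmul eqxx contractU /contract_basis ifF ?linear0 ?addr0 //.
by apply/negbTE; rewrite notin_setE /=; lia.
Qed.

Lemma contract_vacuum_high c p : c < p -> contract p << vacuum c >> = 0 :> fock.
Proof.
by move=> cp; rewrite contractU /contract_basis ifF //; apply/negbTE; rewrite notin_setE /=; lia.
Qed.

Lemma e_op_vacuum c : exists d : nat,
  e_op (c + 1) << vacuum c >> = (-1) ^+ d *: << vacuum (c + 2) >> :> fock.
Proof.
(* psi(i0) is the one of the two fermions c + 1 and c + 2 that is a psi *)
pose i0 : int := ((c + 2) %/ 2)%Z.
rewrite (@e_op_seq [:: i0]) // ?big_seq1; last first.
  move=> i; rewrite inE => ii0; have [ic|ci] := leP (psi i) c.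
    by rewrite vacuum_killed_upto // linear0.
  rewrite rmulC vacuum_killed_upto ?linear0 ?oppr0 //.
  by move: ci ii0; rewrite /psi /phi /i0; lia.
have e2 : rmul (c + 2) (rmul (c + 1) << vacuum c >>) = << vacuum (c + 2) >> :> fock.
  by rewrite rmul_vacuum (_ : c + 2 = c + 1 + 1) ?rmul_vacuum //; lia.
have [o|o] := boolP (odd `|c|).
  exists 0%N; rewrite scale1r -e2.
  by congr (rmul _ (rmul _ _)); rewrite /psi /phi /i0; lia.
exists 1%N; rewrite expr1 scaleN1r -e2 rmulC.
by congr (- rmul _ (rmul _ _)); rewrite /psi /phi /i0; lia.
Qed.

Hypothesis K2 : forall x, x + x = 0 -> x = 0.

(** The relation e(z)^2 = 0.  For fixed psi-indices i and j the terms are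
phi(q) phi(q') with q + q' fixed, and exchanging q and q' changes their sign. *)
Lemma e_op_square (m : nat) x : killed_upto (-1) x ->
  \sum_(a < m.+1) e_op a%:Z (e_op (m%:Z - a%:Z) x) = 0.
Proof.
move=> xl.
have -> : \sum_(a < m.+1) e_op a%:Z (e_op (m%:Z - a%:Z) x) =
    \sum_(a < m.+1) \sum_(i < m.+1) \sum_(j < m.+1)
      rmul (phi (a%:Z - i%:Z)) (rmul (psi i%:Z)
        (rmul (phi (m%:Z - a%:Z - j%:Z)) (rmul (psi j%:Z) x))).
  apply: eq_bigr => a _; rewrite (@e_op_finite_sum m); first last.
  - by have := ltn_ord a; lia.
  - exact: e_op_killed_upto.
  apply: eq_bigr => i _; rewrite (@e_op_finite_sum m) //; last by have := ltn_ord a; lia.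
  by rewrite !linear_sum.
rewrite exchange_big /= big1 // => i _; rewrite exchange_big /= big1 // => j _.
pose z := rmul (psi i%:Z) (rmul (psi j%:Z) x).
pose G (a : nat) := rmul (phi (a%:Z - i%:Z)) (rmul (phi (m%:Z - j%:Z - a%:Z)) z).
have zl : killed_upto (-1) z.
  move=> p p1; rewrite /z rmulC [rmul p _]rmulC xl //.
  by rewrite linear0 oppr0 linear0 oppr0.
transitivity (- \sum_(a < m.+1) G a).
  rewrite -sumrN; apply: eq_bigr => a _; rewrite /G /z.
  rewrite [rmul (psi i%:Z) (rmul (phi _) _)]rmulC linearN.
  by congr (- rmul _ (rmul (phi _) _)); lia.
apply/eqP; rewrite oppr_eq0; apply/eqP.
have jm := ltn_ord j; have im := ltn_ord i.
have Gout (a : nat) : (m < a + j)%N -> G a = 0.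
  by move=> ma; rewrite /G (zl (phi _)) ?linear0 // /phi; lia.
(* the terms with a > m - j vanish, so the range may be taken symmetric under
   a |-> m - j + i - a *)
have shrink M : (m - j < M)%N -> \sum_(a < M) G a = \sum_(a < (m - j).+1) G a.
  move=> jM; rewrite (big_ord_widen M _ jM) [RHS]big_mkcond; apply: eq_bigr => a _.
  by case: ifP => // aj; apply: Gout; lia.
rewrite shrink -?(shrink (m - j + i).+1); try lia.
apply: K2; rewrite {1}(reindex_inj rev_ord_inj) -big_split big1 //= => a _.
have := ltn_ord a => am; rewrite /G.
rewrite [X in X + _]rmulC addrC.
set u := rmul _ _; set v := rmul _ _; suff -> : u = v by rewrite subrr.
by rewrite /u /v; congr (rmul (phi _) (rmul (phi _) _)); lia.
Qed.

End FockCurrent.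

(** * Operators on tensor powers *)

Section Tensor.
Variables (K : comNzRingType) (k : nat).
Local Notation fock := (fock K).
Local Notation fock_tensor := (fock_tensor K k).
Implicit Types (r s : 'I_k) (t : {ffun 'I_k -> fmonomial}) (w : fock_tensor).
Implicit Types (p a d : int) (f g : fock -> fock).

Lemma at_factorC r s f g w : r != s ->
  at_factor r f (at_factor s g w) = at_factor s g (at_factor r f w).
Proof.
move=> rs; elim/malg_lin_ind: w => [|c t w IH]; first by rewrite !linear0.
by rewrite !at_factorP IH at_factorC_neq.
Qed.

Lemma at_factor_comp r (h : {linear fock -> fock}) g w :
  at_factor r h (at_factor r g w) = at_factor r (h \o g) w.
Proof.
elim/malg_lin_ind: w => [|c t w IH]; first by rewrite !linear0.
by rewrite !at_factorP IH [at_factor r g _]at_factorU at_factor_same at_factorU.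
Qed.

Lemma at_factor_add r f g c w :
  at_factor r (fun x => f x + c *: g x) w = at_factor r f w + c *: at_factor r g w.
Proof.
elim/malg_lin_ind: w => [|b t w IH]; first by rewrite !linear0 add0r.
rewrite !at_factorP IH !at_factorU [f _ + _]addrC pure_exceptP.
by rewrite !scalerDr !scalerA [c * b]mulrC [_ *: _ + b *: _]addrC addrACA.
Qed.

(** Only the summand of the coproduct that acts on the factor r sees h. *)
Lemma at_factor_e_tensor r (h g : {linear fock -> fock}) (c : K) a w :
    (forall x, h (e_op a x) = e_op a (h x) + c *: g x) ->
  at_factor r h (e_tensor a w) = e_tensor a (at_factor r h w) + c *: at_factor r g w.
Proof.
move=> hC; rewrite /e_tensor linear_sum /= (bigD1 r) //= [in RHS](bigD1 r) //=.
rewrite !at_factor_comp addrAC; congr (_ + _).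
  rewrite -at_factor_add; congr (at_factor r _ w).
  by apply/funext => x; apply: hC.
by apply: eq_bigr => s sr; rewrite at_factorC // eq_sym.
Qed.

Lemma at_rmul_e_tensor r p a w :
  at_factor r (rmul p) (e_tensor a w) = e_tensor a (at_factor r (rmul p) w).
Proof.
rewrite (@at_factor_e_tensor r (rmul p) (rmul p) 0) ?scale0r ?addr0 // => x.
by rewrite scale0r addr0; apply: rmul_e_op.
Qed.

Lemma at_contract_e_tensor r p a w :
  at_factor r (contract p) (e_tensor a w) =
  e_tensor a (at_factor r (contract p) w)
  - (-1) ^+ `|p|%N *: at_factor r (rmul (2 * a + 1 - p)) w.
Proof.
rewrite (@at_factor_e_tensor r (contract p) (rmul (2 * a + 1 - p)) (- (-1) ^+ `|p|%N)).
  by rewrite scaleNr.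
by move=> x; rewrite scaleNr; apply: contract_e_op.
Qed.

Lemma at_rmul_low r w : exists N : int, forall p, p <= N -> at_factor r (rmul p) w = 0.
Proof.
elim/malg_lin_ind: w => [|c t w [N IH]]; first by exists 0 => p _; rewrite linear0.
have [M tM] := rmul_low (<< t r >> : fock); exists (Num.min N M) => p.
rewrite le_min => /andP[pN pM]; rewrite at_factorP IH // at_factorU tM // linear0.
by rewrite scaler0 addr0.
Qed.

Lemma at_rmul_contract_e_tensor r s q p a w :
  at_factor r (rmul q) (at_factor s (contract p) (e_tensor a w)) =
  e_tensor a (at_factor r (rmul q) (at_factor s (contract p) w))
  - (-1) ^+ `|p|%N *: at_factor r (rmul q) (at_factor s (rmul (2 * a + 1 - p)) w).
Proof.
by rewrite at_contract_e_tensor addrC -scaleNr at_factorP at_rmul_e_tensor addrC scaleNr.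
Qed.

(** The sum over p of (fermion p - d in r0)(contraction of p in r1), plus the same
with r0 and r1 exchanged and a sign, truncated to |p| <= L.  It is the action of the loop
algebra of the symplectic Lie algebra that preserves the two-form e; the parity of d
decides which of its elements occurs.  Truncating avoids an infinite sum: on a given
vector the commutator with e_a vanishes once L is large. *)
Definition exchange r0 r1 d (L : nat) w : fock_tensor :=
  \sum_(p <- int_box L)
    (at_factor r0 (rmul (p - d)) (at_factor r1 (contract p) w) +
     (-1) ^+ `|d|%N *: at_factor r1 (rmul (p - d)) (at_factor r0 (contract p) w)).

Lemma exchange_is_linear r0 r1 d L : linear (exchange r0 r1 d L).
Proof.
move=> a x y; rewrite /exchange scaler_sumr -big_split; apply: eq_bigr => p _ /=.
rewrite !linearP /= [in X in _ = X + _]scalerDr addrACA; congr (_ + _).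
Qed.

HB.instance Definition _ r0 r1 d L :=
  GRing.isLinear.Build K fock_tensor fock_tensor *:%R (exchange r0 r1 d L)
    (exchange_is_linear r0 r1 d L).

(** The commutator of e_a with the first half is the sum of the products (p - d in
r0)(2 a + 1 - p in r1) with signs; that of the second half is the same sum after the
substitution p |-> 2 a + 1 + d - p, with the opposite sign. *)
Lemma exchange_e_tensor r0 r1 d a w : r0 != r1 ->
  exists L0, forall L, (L0 <= L)%N ->
    exchange r0 r1 d L (e_tensor a w) = e_tensor a (exchange r0 r1 d L w).
Proof.
move=> r01; have [N0 w0] := at_rmul_low r0 w; have [N1 w1] := at_rmul_low r1 w.
exists (`|N0| + `|N1| + `|d| + 2 * `|a| + 2)%N => L LN.
(* a vector is killed by the multiplications by all sufficiently low fermions,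
   hence G has finite support and L may be chosen beyond it *)
pose G p := (-1) ^+ `|p|%N *:
  at_factor r0 (rmul (p - d)) (at_factor r1 (rmul (2 * a + 1 - p)) w).
have G0 p : G p != 0 -> (p \in int_box L) && (2 * a + 1 + d - p \in int_box L).
  move=> Gp; have [pN0|pN0] := leP (p - d) N0.
    by move: Gp; rewrite /G (at_factorC _ _ _ r01) w0 // linear0 scaler0 eqxx.
  have [pN1|pN1] := leP (2 * a + 1 - p) N1.
    by move: Gp; rewrite /G w1 // linear0 scaler0 eqxx.
  by rewrite !mem_int_box; lia.
have Grefl p : G (2 * a + 1 + d - p) = - ((-1) ^+ `|d|%N *: ((-1) ^+ `|p|%N *:
    at_factor r1 (rmul (p - d)) (at_factor r0 (rmul (2 * a + 1 - p)) w))).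
  rewrite /G scalerA -scaleNr -exprD (at_factorC _ _ _ r01) -[- (_ ^+ _)]mulN1r -exprS.
  rewrite (_ : 2 * a + 1 + d - p - d = 2 * a + 1 - p); last by lia.
  rewrite (_ : 2 * a + 1 - (2 * a + 1 + d - p) = p - d); last by lia.
  by congr (_ *: _); rewrite -signr_odd -[RHS]signr_odd; congr (_ ^+ nat_of_bool _); lia.
have GG : \sum_(p <- int_box L) (G (2 * a + 1 + d - p) - G p) = 0.
  exact: sum_reflectB (int_box_uniq L) G0.
rewrite /exchange (linear_sum (e_tensor a)) /=.
transitivity (\sum_(p <- int_box L) (e_tensor a
    (at_factor r0 (rmul (p - d)) (at_factor r1 (contract p) w) +
     (-1) ^+ `|d|%N *: at_factor r1 (rmul (p - d)) (at_factor r0 (contract p) w))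
    + (G (2 * a + 1 + d - p) - G p))).
  apply: eq_bigr => p _; rewrite !at_rmul_contract_e_tensor Grefl.
  rewrite [X in _ = e_tensor a X + _]addrC e_tensorP scalerBr /G.
  by rewrite [X in _ = X + _]addrC [in RHS](addrC (- _)) addrACA.
by rewrite big_split /= GG addr0.
Qed.

(** Only the topmost fermion c of the factor r1 can move: a lower one would land on an
occupied place of the factor r0, and all fermions of r0 on occupied places of r1. *)
Lemma exchange_vacuum r0 r1 t (s c : int) L : r0 != r1 -> (`|c| <= L)%N -> s < c ->
    t r0 = vacuum (s - 1) -> t r1 = vacuum c ->
  exchange r0 r1 (c - s) L << t >> =
  << put r0 (put r1 t (vacuum (c - 1))) (vacuum s) >>.
Proof.
move=> r01 cL sc t0 t1; rewrite /exchange (bigD1_seq c) ?int_box_uniq ?mem_int_box //=.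
have second p : at_factor r1 (rmul (p - (c - s))) (at_factor r0 (contract p) << t >>) = 0.
  rewrite [at_factor r0 _ _]at_factorU t0.
  have [ps|sp] := ltP (s - 1) p; first by rewrite contract_vacuum_high // pure_except0 at_factor0.
  rewrite contractU /contract_basis; case: ifP => _; last by rewrite pure_except0 at_factor0.
  rewrite [pure_except _ _ _]linearZ [at_factor _ _ _]linearZ /=.
  rewrite pure_exceptU at_factorU ffunE eq_sym (negPf r01) t1.
  by rewrite vacuum_killed_upto ?pure_except0 ?scaler0 //; lia.
rewrite second scaler0 addr0 [X in _ + X]big1 ?addr0.
  rewrite [at_factor r1 _ _]at_factorU t1 contract_vacuum pure_exceptU at_factorU.
  rewrite ffunE (negPf r01) t0.
  rewrite (_ : c - (c - s) = s - 1 + 1); last by lia.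
  by rewrite rmul_vacuum pure_exceptU subrK.
move=> p pc; rewrite second scaler0 addr0.
rewrite [at_factor r1 _ _]at_factorU t1.
have [cp|cp] := ltP c p; first by rewrite contract_vacuum_high // pure_except0 at_factor0.
rewrite contractU /contract_basis; case: ifP => _; last by rewrite pure_except0 at_factor0.
rewrite [pure_except _ _ _]linearZ [at_factor _ _ _]linearZ /=.
rewrite pure_exceptU at_factorU ffunE (negPf r01) t0.
by rewrite vacuum_killed_upto ?pure_except0 ?scaler0 //; lia.
Qed.

End Tensor.

(** * Polynomials acting on tensors *)

Lemma mpoly_alg_ind (K : comNzRingType) (n : nat) (P : {mpoly K[n]} -> Prop) :
    (forall c, P c%:MP) -> (forall i, P 'X_i) ->
    (forall p q, P p -> P q -> P (p + q)) -> (forall p q, P p -> P q -> P (p * q)) ->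
  forall p, P p.
Proof.
move=> PC PX PD PM; have P1 : P 1 by rewrite -mpolyC1.
have Pexp p d : P p -> P (p ^+ d).
  by move=> Pp; elim: d => // d IH; rewrite exprS; apply: PM.
elim/mpolyind => [|c m p _ _ IH]; first by rewrite -mpolyC0.
apply: PD => //; rewrite -mul_mpolyC; apply: (PM) => //; rewrite mpolyXE_id.
by apply: big_ind => // i _; apply: Pexp.
Qed.

Section GenericAction.
Variables (K : comNzRingType) (N : nat) (V : lmodType K).
Variable T : 'I_N -> {linear V -> V}.
Hypothesis TC : forall i j x, T i (T j x) = T j (T i x).

Lemma poly_actX (i : 'I_N) (x : V) : poly_act T 'X_i x = T i x.
Proof.
have -> : 'X_i = 1 *: 'X_[U_(i)] :> {mpoly K[N]} by rewrite scale1r.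
rewrite poly_actZX scale1r /monomial_act.
have out s : i \notin s -> foldr (fun j => iter (U_(i)%MM j) (T j)) x s = x.
  elim: s => //= j s IH; rewrite inE negb_or => /andP[ij /IH ->].
  by rewrite mnm1E (negPf ij).
have : i \in enum 'I_N by rewrite mem_enum.
elim: (enum _) (enum_uniq 'I_N) => //= j s IH /andP[js us].
rewrite inE mnm1E; case: eqVneq => [ij|ij] /=; last by move/(IH us).
by rewrite out ?ij.
Qed.

Lemma poly_actC c (x : V) : poly_act T c%:MP x = c *: x.
Proof.
have -> : c%:MP = c *: 'X_[0%MM] :> {mpoly K[N]} by rewrite mpolyX0 alg_mpolyC.
by rewrite poly_actZX monomial_act0.
Qed.

Lemma poly_act_annihilator x : is_ideal (fun p : {mpoly K[N]} => poly_act T p x = 0).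
Proof.
split=> [|p q px qx|a p px]; first by rewrite poly_act0l.
  by rewrite poly_actDl px qx addr0.
by rewrite -poly_actA // px poly_act0r.
Qed.

End GenericAction.

Section Transfer.
Variables (K : comNzRingType) (n : nat).

Lemma e_actC (k : nat) c (w : fock_module K n k) :
  c%:MP *: w = c *: (w : fock_tensor K k) :> fock_tensor K k.
Proof.
exact: (poly_actC (fun i : 'I_n => e_tensor i%:Z : {linear fock_tensor K k -> fock_tensor K k})).
Qed.

(** An operator that commutes with the e_i carries relations of v to relations of
its image.  The operator is given as a limit that is stationary on each vector. *)
Lemma annihilator_transfer (k k' : nat)
    (X : nat -> {linear fock_tensor K k -> fock_tensor K k'})
    (v : fock_module K n k) (v' : fock_module K n k') :
    (forall (i : 'I_n) w, exists L0, forall L, (L0 <= L)%N ->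
       X L (e_tensor i%:Z w) = e_tensor i%:Z (X L w)) ->
    (exists L0, forall L, (L0 <= L)%N -> X L v = v') ->
  forall p : {mpoly K[n]}, p *: v = 0 -> p *: v' = 0.
Proof.
move=> XC [L1 Xv] p.
have [L0 XL] : exists L0, forall L, (L0 <= L)%N ->
    X L (p *: v) = p *: (X L v : fock_module K n k') :> fock_module K n k'.
  elim/mpoly_alg_ind: p v {Xv} => [c|i|p q IHp IHq|p q IHp IHq] w.
  - by exists 0%N => L _; rewrite !e_actC; exact: linearZ.
  - have [L0 XL] := XC i w; exists L0 => L LL; rewrite !e_actX; exact: XL.
  - have [Lp Xp] := IHp w; have [Lq Xq] := IHq w; exists (Lp + Lq)%N => L LL.
    have XD : X L ((p + q) *: w) = X L (p *: w) + X L (q *: w).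
      by rewrite scalerDl; exact: linearD.
    rewrite XD Xp; last by lia.
    by rewrite Xq; [rewrite [RHS]scalerDl|lia].
  - have [Lp Xp] := IHp (q *: w); have [Lq Xq] := IHq w; exists (Lp + Lq)%N => L LL.
    rewrite -[in LHS]scalerA Xp; last by lia.
    by rewrite Xq; [rewrite [LHS]scalerA|lia].
move=> pv; rewrite -(Xv (L0 + L1)%N); last by lia.
by rewrite -XL; [rewrite pv; exact: linear0|lia].
Qed.

End Transfer.

Definition vacuum_tensor (K : comNzRingType) (n k : nat) (D : 'I_k -> nat) : fock_module K n k :=
  << [ffun r => vacuum ((D r)%:Z - 1)] >>.

(** * Tensor products of vacuum vectors *)

Section ExtraFactor.
Variables (K : comNzRingType) (k : nat) (b : fmonomial).

Definition add_factor (t : {ffun 'I_k -> fmonomial}) : {ffun 'I_k.+1 -> fmonomial} :=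
  [ffun r => oapp t b (unlift ord0 r)].

Definition add_factor_lin : {linear fock_tensor K k -> fock_tensor K k.+1} :=
  linext (fun t => << add_factor t >> : fock_tensor K k.+1).

Lemma put_add_factor r t c :
  put (lift ord0 r) (add_factor t) c = add_factor (put r t c).
Proof.
apply/ffunP => u; rewrite !ffunE; case: unliftP => [j ->|->] /=.
  by rewrite (inj_eq lift_inj) ffunE.
by [].
Qed.

Lemma add_factor_linU t : add_factor_lin << t >> = << add_factor t >>.
Proof. exact: linextU. Qed.

Lemma add_factor_pure_except r t (x : fock K) :
  add_factor_lin (pure_except r t x) = pure_except (lift ord0 r) (add_factor t) x.
Proof.
elim/malg_lin_ind: x => [|c b' x IH]; first by rewrite !pure_except0; exact: linear0.
rewrite !pure_exceptP -IH !pure_exceptU put_add_factor -add_factor_linU.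
exact: linearP.
Qed.

(** The new factor contributes nothing to the coproduct of a mode that kills b. *)
Lemma add_factor_e_tensor (a : int) w : e_op a (<< b >> : fock K) = 0 ->
  add_factor_lin (e_tensor a w) = e_tensor a (add_factor_lin w).
Proof.
move=> ab.
have basis t : add_factor_lin (e_tensor a << t >>) = e_tensor a << add_factor t >>.
  rewrite /e_tensor big_ord_recl at_factorU ffunE unlift_none /= ab pure_except0 add0r.
  rewrite linear_sum; apply: eq_bigr => r _ /=.
  by rewrite !at_factorU ffunE liftK add_factor_pure_except.
pose Phi (x : fock_tensor K k) := add_factor_lin x.
have PhiP c x y : Phi (c *: x + y) = c *: Phi x + Phi y by exact: linearP.
rewrite -/(Phi _) -/(Phi _); elim/malg_lin_ind: w => [|c t w IH].
  by rewrite e_tensor0 (_ : Phi 0 = 0) ?e_tensor0 //; exact: linear0.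
by rewrite e_tensorP !PhiP e_tensorP IH [Phi _]basis [Phi << t >>]add_factor_linU.
Qed.

End ExtraFactor.

Section VacuumTensors.
Variables (K : comNzRingType) (n : nat).
Implicit Types p : {mpoly K[n]}.

Lemma e_op_vacuum0 (a d : nat) : (a < d)%N ->
  e_op a%:Z (<< vacuum (d%:Z - 1) >> : fock K) = 0.
Proof. by move=> ad; apply: (e_op_eq0 (@vacuum_killed_upto K _)); lia. Qed.

Lemma annihilator_add_factor k (D : 'I_k -> nat) (d : nat) p : (n <= d)%N ->
  p *: vacuum_tensor K n D = 0 -> p *: vacuum_tensor K n (fun r => oapp D d (unlift ord0 r)) = 0.
Proof.
move=> nd; apply: (@annihilator_transfer _ _ _ _
  (fun _ => add_factor_lin K k (vacuum (d%:Z - 1)))).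
  move=> i w; exists 0%N => L _; apply: add_factor_e_tensor; apply: e_op_vacuum0.
  exact: leq_trans (ltn_ord i) nd.
exists 0%N => L _; apply: etrans (add_factor_linU _ _ _) _; congr << _ >>.
by apply/ffunP => r; rewrite !ffunE; case: unliftP => [j _|_] /=; rewrite ?ffunE.
Qed.

(** The fermion D_(r1) - 1 of the factor r1 moves to the place s of the factor r0. *)
Lemma annihilator_exchange k (D : 'I_k -> nat) (s : nat) (r0 r1 : 'I_k) p :
    D r0 = s -> (s.+2 <= D r1)%N -> p *: vacuum_tensor K n D = 0 ->
  p *: vacuum_tensor K n (fun r =>
    if r == r0 then s.+1 else if r == r1 then (D r1).-1 else D r) = 0.
Proof.
move=> D0 D1; have r01 : r0 != r1 by apply: contraTneq D1 => <-; lia.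
apply: (@annihilator_transfer _ _ _ _
  (fun L => exchange r0 r1 ((D r1)%:Z - 1 - s%:Z) L : {linear _ -> _})).
  by move=> i w; apply: exchange_e_tensor.
exists (D r1) => L DL.
rewrite /vacuum_tensor [LHS](@exchange_vacuum _ _ _ _ _ s%:Z ((D r1)%:Z - 1) L r01) ?ffunE ?D0 //; try lia.
congr << _ >>; apply/ffunP => r; rewrite !ffunE.
by case: eqP => // _; [|case: eqP => // _]; congr vacuum; lia.
Qed.

Lemma e_tensor_vacuum_tensor k (D : 'I_k -> nat) (s : nat) (d : nat) :
    e_op s%:Z << vacuum (s%:Z - 1) >> =
      (-1) ^+ d *: << vacuum (s%:Z + 1) >> :> fock K ->
    (forall r, (s <= D r)%N) ->
  e_tensor s%:Z (vacuum_tensor K n D : fock_tensor K k) =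
  \sum_(r | D r == s) (-1) ^+ d *:
     (vacuum_tensor K n (fun u => if u == r then s.+2 else D u) : fock_tensor K k).
Proof.
move=> es Ds; rewrite [RHS]big_mkcond; apply: eq_bigr => r _.
rewrite /vacuum_tensor at_factorU ffunE; case: eqP => [->|/eqP Dr].
  rewrite es [LHS]linearZ /= pure_exceptU; congr (_ *: << _ >>).
  by apply/ffunP => u; rewrite !ffunE; case: ifP => _ //; congr vacuum; lia.
by rewrite e_op_vacuum0 ?pure_except0 // ltn_neqAle eq_sym Dr Ds.
Qed.

(** Each e_s raises one of the p lowest factors by 2 and kills the raised ones, so the
p-th power meets every order of raising them: this is the factor p!. *)
Lemma e_pow_vacuum_tensor k (D : 'I_k -> nat) (s : 'I_n) (p : nat) :
    (forall r, (s <= D r)%N) -> #|[pred r | D r == s]| = p ->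
  exists d : nat, 'X_s ^+ p *: vacuum_tensor K n D =
    ((-1) ^+ d *+ p`!)%:MP *: vacuum_tensor K n (fun r => if D r == s then s.+2 else D r).
Proof.
move=> Ds Dp; have [d es] := @e_op_vacuum K (s%:Z - 1).
rewrite subrK (_ : s%:Z - 1 + 2 = s%:Z + 1) in es; last by lia.
exists (d * p)%N; elim: p D Ds Dp => [|p IH] D Ds Dp.
  rewrite expr0 scale1r muln0 fact0 mpolyC1 scale1r; congr (_ : fock_module K n k).
  congr << _ >>; apply/ffunP => r; rewrite !ffunE ifN //.
  by have := card0_eq Dp r; rewrite inE => ->.
rewrite exprSr -scalerA e_actX [e_tensor _ _](e_tensor_vacuum_tensor es Ds).
have step r : D r == s -> 'X_s ^+ p *: vacuum_tensor K n (fun u => if u == r then s.+2 else D u) =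
    ((-1) ^+ (d * p) *+ p`!)%:MP *: vacuum_tensor K n (fun u => if D u == s then s.+2 else D u).
  move=> Dr; rewrite IH.
  - congr (_ *: _); congr << _ >>; apply/ffunP => u; rewrite !ffunE.
    by case: (eqVneq u r) => [->|//]; rewrite Dr ifN //; lia.
  - by move=> u; case: ifP => // _; lia.
  - apply: succn_inj; rewrite -Dp (cardD1 r) [in RHS](cardD1 r) !inE eqxx Dr.
    rewrite (_ : (s.+2 == s) = false) ?add1n; last by lia.
    rewrite /= -[in RHS]add1n add0n; congr (_.+1); apply: eq_card => u; rewrite !inE.
    by case: eqP.
rewrite (_ : \sum_(r | D r == s) _ = \sum_(r | D r == s) ((-1) ^+ d)%:MP *:
   vacuum_tensor K n (fun u => if u == r then s.+2 else D u)); last first.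
  by apply: eq_bigr => r _; rewrite e_actC.
rewrite scaler_sumr (eq_bigr (fun=> ((-1) ^+ (d * p.+1) *+ p`!)%:MP *:
   vacuum_tensor K n (fun u => if D u == s then s.+2 else D u))); last first.
  move=> r Dr; rewrite scalerA mulrC -scalerA (step r Dr) scalerA -mpolyCM mulrnAr -exprD.
  by rewrite mulnS.
rewrite sumr_const -scaler_nat scalerA.
have -> : #|[pred r | D r == s]| = p.+1 by [].
have cst : p.+1%:R * ((-1) ^+ (d * p.+1) *+ p`!)%:MP =
    ((-1) ^+ (d * p.+1) *+ (p.+1)`!)%:MP :> {mpoly K[n]}.
  by rewrite mulr_natl -mpolyCMn -mulrnA factS [(p.+1 * _)%N]mulnC.
by rewrite cst.
Qed.

End VacuumTensors.

(** * The relations hold on the vacuum tensors *)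

Section FactorModes.
Variables (K : comNzRingType) (k M : nat).
Local Notation index := 'I_#|{: 'I_k * 'I_M}|.
Local Notation fock_tensor := (fock_tensor K k).
Local Notation modes := {mpoly K[#|{: 'I_k * 'I_M}|]}.

(** The modes e_m of a single tensor factor r, for all pairs (r, m), taken as
independent commuting variables.  M may exceed n, because the
relation e(z)^2 = 0 involves modes of index at least n. *)
Definition factor_mode (j : index) : {linear fock_tensor -> fock_tensor} :=
  at_factor (enum_val j).1 (e_op (enum_val j).2%:Z).

Lemma factor_modeC i j x : factor_mode i (factor_mode j x) = factor_mode j (factor_mode i x).
Proof.
rewrite /factor_mode /=; set r := (enum_val i).1; set s := (enum_val j).1.
have [->|rs] := eqVneq r s; last exact: at_factorC.
rewrite !at_factor_comp; congr (at_factor _ _ x); apply/funext => y /=.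
exact: e_opC.
Qed.

Definition mode (r : 'I_k) (m : 'I_M) : modes := 'X_(enum_rank (r, m)).

Lemma mode_act r m w : poly_act factor_mode (mode r m) w = at_factor r (e_op m%:Z) w.
Proof. by rewrite /mode poly_actX /factor_mode /= enum_rankK. Qed.

Variables (n : nat) (nM : (n <= M)%N).

Definition coproduct : n.-tuple modes :=
  [tuple \sum_(r < k) mode r (widen_ord nM i) | i < n].

Lemma coproduct_act (p : {mpoly K[n]}) (w : fock_tensor) :
  poly_act factor_mode (p \mPo coproduct) w = p *: (w : fock_module K n k).
Proof.
elim/mpoly_alg_ind: p w => [c|i|p q IHp IHq|p q IHp IHq] w.
- by rewrite comp_mpolyC poly_actC e_actC.
- rewrite comp_mpolyXU -tnth_nth tnth_mktuple e_actX /e_tensor.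
  elim/big_rec2: _ => [|r y1 y2 _ IH]; first by rewrite poly_act0l.
  by rewrite poly_actDl IH mode_act.
- by rewrite rmorphD poly_actDl IHp IHq scalerDl.
- by rewrite rmorphM -(poly_actA factor_modeC) IHq IHp scalerA.
Qed.

Definition current (r : 'I_k) : {poly modes} := \sum_(m < M) mode r m *: 'X^m.
Definition low_current (r : 'I_k) : {poly modes} :=
  \sum_(i < n) mode r (widen_ord nM i) *: 'X^i.

Lemma coproduct_e_poly i m :
  ((e_poly K n ^+ i)`_m) \mPo coproduct = ((\sum_(r < k) low_current r) ^+ i)`_m.
Proof.
have <- : map_poly (fun p => p \mPo coproduct) (e_poly K n) = \sum_(r < k) low_current r.
  rewrite rmorph_sum exchange_big; apply: eq_bigr => j _ /=.
  rewrite map_polyZ map_polyXn /= comp_mpolyXU -tnth_nth tnth_mktuple.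
  by rewrite scaler_suml.
by rewrite -rmorphXn coef_map.
Qed.

Lemma coef_current r (m : nat) (mM : (m < M)%N) : (current r)`_m = mode r (Ordinal mM).
Proof.
rewrite coef_sum (bigD1 (Ordinal mM)) //= coefZ coefXn eqxx mulr1 big1 ?addr0 //.
move=> j jm; rewrite coefZ coefXn [m == j](_ : _ = false) ?mulr0 //.
by apply: contra_neqF jm => /eqP mj; apply/val_inj.
Qed.

Lemma low_current_trunc r : exists w, low_current r = current r - 'X^n * w.
Proof.
exists (\sum_(m < M | (n <= m)%N) mode r m *: 'X^(m - n)).
rewrite mulr_sumr /current (bigID (fun m : 'I_M => (m < n)%N)) /=.
have -> : \sum_(m < M | ~~ (m < n)%N) mode r m *: 'X^m =
    \sum_(m < M | (n <= m)%N) 'X^n * (mode r m *: 'X^(m - n)) :> {poly modes}.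
  apply: eq_big => [m|m nm]; first by rewrite -leqNgt.
  by rewrite -scalerAr -exprD subnKC // leqNgt.
rewrite addrK /low_current.
pose H (m : nat) : {poly modes} := if insub m is Some m' then mode r m' *: 'X^m' else 0.
transitivity (\sum_(i < n) H i).
  by apply: eq_bigr => i _; rewrite /H (insubT (fun m => m < M)%N (leq_trans (ltn_ord i) nM)) /=;
    congr (mode _ _ *: _); apply: val_inj.
by rewrite (big_ord_widen M H nM); apply: eq_bigr => m _; rewrite /H valK.
Qed.

Variable D : 'I_k -> nat.
Local Notation kills := (fun p : modes =>
  poly_act factor_mode p (vacuum_tensor K n D : fock_tensor) = 0).

Lemma current_vanish r : vanish kills (minn (D r) M) (current r).
Proof.
move=> m; rewrite ltn_min => /andP[mD mM]; rewrite (coef_current r mM) mode_act.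
by rewrite /vacuum_tensor at_factorU ffunE e_op_vacuum0 // pure_except0.
Qed.

Hypothesis K2 : forall x : fock K, x + x = 0 -> x = 0.

Lemma current_square_vanish r : vanish kills M (current r ^+ 2).
Proof.
move=> m mM; rewrite expr2 coefM.
transitivity (\sum_(a < m.+1) at_factor r (e_op a%:Z)
   (at_factor r (e_op (m%:Z - a%:Z)) (vacuum_tensor K n D : fock_tensor))).
  have aux : forall (s : seq 'I_m.+1), poly_act factor_mode
    (\sum_(a <- s) (current r)`_a * (current r)`_(m - a))
      (vacuum_tensor K n D : fock_tensor) = \sum_(a <- s) at_factor r (e_op a%:Z)
   (at_factor r (e_op (m%:Z - a%:Z)) (vacuum_tensor K n D : fock_tensor)).
    elim=> [|a s IH]; first by rewrite !big_nil poly_act0l.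
    have am := ltn_ord a.
    have aM : (a < M)%N by lia.
    have maM : (m - a < M)%N by lia.
    rewrite !big_cons poly_actDl IH (coef_current r aM) (coef_current r maM).
    rewrite -(poly_actA factor_modeC) !mode_act /=.
    by rewrite (_ : (m - a)%N%:Z = m%:Z - a%:Z) //; lia.
  exact: aux.
rewrite /vacuum_tensor.
have step (a : 'I_m.+1) :
  at_factor r (e_op a%:Z) (at_factor r (e_op (m%:Z - a%:Z)) (vacuum_tensor K n D : fock_tensor)) =
  pure_except r [ffun r => vacuum ((D r)%:Z - 1)]
    (e_op a%:Z (e_op (m%:Z - a%:Z) << vacuum ((D r)%:Z - 1) >>)).
  by rewrite /vacuum_tensor at_factorU at_factor_same ffunE.
rewrite (eq_bigr _ (fun a _ => step a)) -linear_sum /= e_op_square ?linear0 //.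
by move=> p p1; apply: (@vacuum_killed_upto K); lia.
Qed.

(** The square of the full current vanishes only to order M, hence the bound on a. *)
Lemma low_current_vanish r a : (n * a <= M)%N ->
  vanish kills (\sum_(m < n) (a - (D r <= m)%N))%N (low_current r ^+ a).
Proof.
move=> naM; have [w ->] := low_current_trunc r.
have II := poly_act_annihilator factor_modeC (vacuum_tensor K n D : fock_tensor).
have := vanish_truncated_pow II w (@current_vanish r) (@current_square_vanish r) naM.
apply: vanishW; apply: leq_sum => m _; have := ltn_ord m. lia.
Qed.

End FactorModes.

(** The exponent sum_j (i + 1 - a_j)_+ in terms of the levels; see
[zero_order_partition]. *)
Definition zero_order (n k : nat) (D : 'I_k -> nat) (i : nat) : nat :=
  \sum_(m < n) (i - #|[pred r | (D r <= m)%N]|).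

Definition fusion_ideal (K : comNzRingType) (n : nat) (w : nat -> nat) : {mpoly K[n]} -> Prop :=
  ideal_span (fun g => exists i m, (m < w i)%N /\ g = (e_poly K n ^+ i)`_m).

Lemma annihilator_ideal (B : comNzRingType) (V : lmodType B) (v : V) :
  is_ideal (fun p : B => p *: v = 0).
Proof.
split=> [|p q pv qv|a p pv]; first by rewrite scale0r.
  by rewrite scalerDl pv qv addr0.
by rewrite -scalerA pv scaler0.
Qed.

Lemma fusion_ideal_kills (K : comNzRingType) (n k : nat) (D : 'I_k -> nat) p :
    (forall x : fock K, x + x = 0 -> x = 0) ->
  fusion_ideal (zero_order n D) p -> p *: vacuum_tensor K n D = 0.
Proof.
move=> K2; apply: (ideal_span_min (annihilator_ideal (vacuum_tensor K n D))).
move=> _ [i [m [mi ->]]]; have nM : (n <= n * i.+1)%N by rewrite mulnS leq_addr.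
rewrite -(coproduct_act nM) coproduct_e_poly.
have II := poly_act_annihilator (@factor_modeC K k (n * i.+1)) (vacuum_tensor K n D : fock_tensor K k).
apply: (vanish_sum_pow (i := i) (n := n) (eps := fun r m => (D r <= m)%N) II).
  by move=> r a ai; apply: low_current_vanish => //; rewrite leq_mul2l leqW ?orbT.
apply: leq_trans mi _; apply: leq_sum => j _; rewrite -sum1_card big_mkcond.
by apply: leq_sub2l; apply: leq_sum => r _; rewrite inE /=; case: (D r <= j)%N.
Qed.

(** * Counting zeros *)

Section Levels.
Variables (k : nat).
Implicit Types D : 'I_k -> nat.

Definition level_count D (m : nat) : nat := #|[pred r | (D r <= m)%N]|.

Lemma level_count_low D s m : (forall r, (s <= D r)%N) -> (m < s)%N -> level_count D m = 0%N.
Proof.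
by move=> Ds ms; apply: eq_card0 => r; rewrite !inE leqNgt (leq_trans ms (Ds r)).
Qed.

(** The positions below s contribute i each, and the position s counts the factors
of level exactly s. *)
Lemma zero_order_split n D s i : (s < n)%N -> (forall r, (s <= D r)%N) ->
  zero_order n D i =
  (s * i + (i - #|[pred r | D r == s]|)
   + \sum_(s.+1 <= m < n) (i - level_count D m))%N.
Proof.
move=> sn Ds; rewrite /zero_order -(big_mkord xpredT (fun m => i - level_count D m)%N).
rewrite (big_cat_nat (n := s)) ?(ltnW sn) //= (big_ltn sn) addnA.
congr (_ + _ + _)%N; last first.
  by congr (_ - _)%N; apply: eq_card => r; rewrite !inE eqn_leq (Ds r) andbT.
rewrite (eq_big_nat _ _ (F2 := fun=> i)); first by rewrite sum_nat_const_nat subn0.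
by move=> m /andP[_ ms]; rewrite (level_count_low Ds ms) subn0.
Qed.

Definition raise_bottom D s (r : 'I_k) : nat := if D r == s then s.+2 else D r.

Definition exchange_levels D s r0 r1 (r : 'I_k) : nat :=
  if r == r0 then s.+1 else if r == r1 then (D r1).-1 else D r.

(** Raising the bottom levels lowers the counts only at s and s + 1, by p each, and
each of these changes costs at most p - q. *)
Lemma zero_order_raise n D s p l q :
    (s < n)%N -> (forall r, (s <= D r)%N) -> #|[pred r | D r == s]| = p -> (q <= p)%N ->
  (zero_order n (raise_bottom D s) l + s * q <= zero_order n D (l + q) + 2 * (p - q))%N.
Proof.
move=> sn Ds Dp qp.
have Ds' r : (s <= raise_bottom D s r)%N by rewrite /raise_bottom; case: ifP => // _; lia.
rewrite !(zero_order_split _ sn) // Dp [#|_|]eq_card0 ?subn0; last first.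
  by move=> r; rewrite !inE /raise_bottom; case: (eqVneq (D r) s) => [_|/negPf //]; lia.
have -> : (2 * (p - q) = (p - q) + (p - q))%N by lia.
suff : (\sum_(s.+1 <= m < n) (l - level_count (raise_bottom D s) m) <=
        \sum_(s.+1 <= m < n) (l + q - level_count D m) + (p - q))%N by lia.
apply: (@leq_trans (\sum_(s.+1 <= m < n)
    ((l + q - level_count D m) + (if m == s.+1 then p - q else 0)))%N).
  rewrite big_nat_cond [in X in (_ <= X)%N]big_nat_cond; apply: leq_sum => m.
  rewrite andbT => /andP[sm mn].
  suff : (level_count D m <= level_count (raise_bottom D s) m + (if m == s.+1 then p else 0))%N.
    by case: ifP; lia.
  rewrite /level_count -Dp; case: eqP => [_|/eqP ms]; last first.
    rewrite addn0; apply: subset_leq_card; apply/fintype.subsetP => r; rewrite !inE /raise_bottom.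
    by case: ifP => // _ _; lia.
  rewrite -(cardID [pred r | D r == s]) addnC leq_add //; apply: subset_leq_card.
    by apply/fintype.subsetP => r; rewrite !inE /raise_bottom => /andP[/negPf -> ->].
  by apply/fintype.subsetP => r; rewrite !inE => /andP[].
rewrite big_split leq_add2l -big_mkcond /=.
have [sn'|sn'] := ltnP s.+1 n; last by rewrite big_geq.
rewrite big_ltn_cond // eqxx big_nat_cond big_pred0 ?addn0 // => m.
by apply/negbTE/negP => /andP[]; lia.
Qed.

Lemma card_exchange D s r0 r1 l :
    (forall r, (s <= D r)%N) -> D r0 = s -> (s.+2 <= D r1)%N ->
    #|[pred r | D r == s]| = l.+1 ->
  #|[pred r | exchange_levels D s r0 r1 r == s]| = l.
Proof.
move=> Ds D0 D1; rewrite (cardD1 r0) !inE D0 eqxx => -[<-]; apply: eq_card => r.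
rewrite !inE /exchange_levels; case: (eqVneq r r0) => [_|_] /=; first by lia.
by case: (eqVneq r r1) => [->|//]; lia.
Qed.

(** Passing from D to the exchanged levels, the summand at s grows by at most one and
the one at D_(r1) - 1 decreases, unless it is zero or D_(r1) - 1 >= n.  In that case all
summands above s are zero, because the counts are constant between s + 1 and D_(r1) - 1,
and the bound is s i + (i - p) exactly. *)
Lemma zero_order_exchange n D s r0 r1 i m :
    (s < n)%N -> (forall r, (s <= D r)%N) -> D r0 = s ->
    (s.+2 <= D r1)%N -> (D r1 <= maxn n s.+2)%N ->
    (forall r, (s.+2 <= D r)%N -> (D r1 <= D r)%N) ->
    (m < zero_order n (exchange_levels D s r0 r1) i)%N ->
    (zero_order n D i <= m)%N ->
  let p := #|[pred r | D r == s]| in (p <= i)%N /\ (m < s * i + (i - p).+1)%N.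
Proof.
move=> sn Ds D0 D1 D1n D1min mi im p.
have r01 : r1 != r0 by apply: contraTneq D1 => ->; lia.
have Ds' r : (s <= exchange_levels D s r0 r1 r)%N.
  by rewrite /exchange_levels; do 2 (case: ifP => _; first by lia).
move: mi im; rewrite !(zero_order_split _ sn) // -/p.
have -> : p = #|[pred r | exchange_levels D s r0 r1 r == s]|.+1.
  have p0 : (0 < p)%N by apply/card_gt0P; exists r0; rewrite inE D0.
  by rewrite (card_exchange Ds D0 D1 (esym (prednK p0))) prednK.
move: #|_| => q.
have counts j : (s < j)%N ->
    level_count (exchange_levels D s r0 r1) j = (level_count D j + (j == (D r1).-1))%N.
  move=> sj; rewrite /level_count (cardD1 r1) [in RHS](cardD1 r1) !inE.
  rewrite /exchange_levels (negPf r01) eqxx.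
  rewrite (_ : #|[predD1 _ & _]| = #|[predD1 [pred r | (D r <= j)%N] & r1]|).
    by rewrite [RHS]addnAC; congr (_ + _)%N; move: D1; case: (D r1) => [|d] //=; case: (ltngtP j d); lia.
  apply: eq_card => r; rewrite !inE; case: (eqVneq r r1) => //= _.
  by case: (eqVneq r r0) => [->|//]; lia.
set R := (\sum_(_ <= j < _) (i - level_count D j))%N; set R' := (\sum_(_ <= j < _) _)%N.
have R'R : (R' <= R)%N.
  rewrite /R' /R big_nat_cond [in X in (_ <= X)%N]big_nat_cond.
  by apply: leq_sum => j; rewrite andbT => /andP[sj _]; rewrite counts //; lia.
have [R0|Rpos] := posnP R; first by lia.
suff : (R' < R)%N by lia.
have [j /andP[sj jn] ij] : exists2 j, (s < j < n)%N & (level_count D j < i)%N.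
  have [/existsP[j /andP[sj ij]]|/existsPn none] :=
      boolP [exists j : 'I_n, (s < j)%N && (level_count D j < i)%N].
    by exists j => //; rewrite sj ltn_ord.
  move: Rpos; rewrite /R big_nat_cond big1 // => j; rewrite andbT => /andP[sj jn].
  by apply/eqP; have := none (Ordinal jn); rewrite /= sj -leqNgt.
have mu : (s < (D r1).-1 < n)%N by lia.
have Nmu : (level_count D (D r1).-1 <= level_count D j)%N.
  apply: subset_leq_card; apply/fintype.subsetP => r; rewrite !inE => Dr.
  have := D1min r; lia.
rewrite /R /R' (bigD1_seq (D r1).-1) ?mem_index_iota ?iota_uniq //=.
rewrite [X in (_ < X)%N](bigD1_seq (D r1).-1) ?mem_index_iota ?iota_uniq //=.
rewrite counts ?eqxx; last by lia.
rewrite -addSn leq_add //; first by lia.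
rewrite big_nat_cond [in X in (_ <= X)%N]big_nat_cond.
by apply: leq_sum => l /andP[/andP[sl _] _]; rewrite counts //; lia.
Qed.

Lemma card_add_factor (P : pred nat) D d :
  #|[pred r : 'I_k.+1 | P (oapp D d (unlift ord0 r))]| = (P d + #|[pred r | P (D r)]|)%N.
Proof.
rewrite -!sum1_card big_mkcond big_ord_recl [in RHS]big_mkcond /=.
congr (_ + _)%N; first by rewrite !inE unlift_none /=; case: (P d).
by apply: eq_bigr => r _; rewrite !inE liftK.
Qed.

Lemma zero_order_add_factor n D d i : (n <= d)%N ->
  zero_order n (fun r : 'I_k.+1 => oapp D d (unlift ord0 r)) i = zero_order n D i.
Proof.
move=> nd; apply: eq_bigr => m _; rewrite (card_add_factor (fun x => x <= m)%N).
by rewrite leqNgt (leq_trans (ltn_ord m) nd).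
Qed.

End Levels.

(** * The relations generate the annihilator *)

Section Annihilators.
Variables (K : numFieldType) (n : nat).
Implicit Types (p q : {mpoly K[n]}) (k s : nat).

Lemma coef_e_poly (i : 'I_n) : (e_poly K n)`_i = 'X_i.
Proof.
rewrite coef_sum (bigD1 i) //= coefZ coefXn eqxx mulr1 big1 ?addr0 //.
move=> j ji; rewrite coefZ coefXn (_ : (i == j :> nat) = false) ?mulr0 //.
by apply/negbTE; rewrite eq_sym.
Qed.

Lemma fock_no_2torsion (x : fock K) : x + x = 0 -> x = 0.
Proof.
move=> xx; have : (2%:R : K) *: x = 0 by rewrite scaler_nat mulr2n.
move/(congr1 (fun y => (2%:R : K)^-1 *: y)); rewrite scalerA mulVf ?pnatr_eq0 // scale1r.
by move=> ->; exact: scaler0.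
Qed.

Lemma e_actC_inj k (c : K) (v : fock_module K n k) : c != 0 -> c%:MP *: v = 0 -> v = 0.
Proof.
move=> c0 cv; rewrite -[v]scale1r -mpolyC1 -(mulVf c0) mpolyCM -scalerA cv.
exact: scaler0.
Qed.

Lemma mpoly_div_nat (d : nat) (w : nat -> nat) p :
  fusion_ideal w (p *+ d.+1) -> fusion_ideal w p.
Proof.
have [_ _ JM] := ideal_span_ideal
  (fun g : {mpoly K[n]} => exists i m, (m < w i)%N /\ g = (e_poly K n ^+ i)`_m).
move/(JM ((d.+1%:R)^-1%:MP)); rewrite -[p *+ _]mulr_natl mulrA -mpolyC_nat -mpolyCM.
by rewrite mulVf ?pnatr_eq0 // mpolyC1 mul1r.
Qed.

Lemma fusion_ideal_vanish (w : nat -> nat) i :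
  vanish (@fusion_ideal K n w) (w i) (e_poly K n ^+ i).
Proof. by move=> m mw; apply: ideal_span_gen; exists i, m. Qed.

Lemma fusion_ideal_ideal (w : nat -> nat) : is_ideal (@fusion_ideal K n w).
Proof. exact: ideal_span_ideal. Qed.

Lemma e_poly_vanish k (D : 'I_k -> nat) (s : 'I_n) : (forall r, (s <= D r)%N) ->
  vanish (@fusion_ideal K n (zero_order n D)) s (e_poly K n).
Proof.
move=> Ds; rewrite -[e_poly K n]expr1.
apply: vanishW (@fusion_ideal_vanish (zero_order n D) 1).
by rewrite (zero_order_split _ (ltn_ord s) Ds) muln1 -addnA leq_addr.
Qed.

(** Modulo J(D) the polynomial e(z) starts with e_s z^s, so the bound on powers of
the lowest coefficient applies. *)
Lemma fusion_ideal_raise k (D : 'I_k -> nat) (s : 'I_n) p :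
    (forall r, (s <= D r)%N) ->
    fusion_ideal (zero_order n (raise_bottom D s)) p ->
  fusion_ideal (zero_order n D) ('X_s ^+ #|[pred r | D r == s]| * p).
Proof.
move=> Ds; set J := fusion_ideal (zero_order n D).
have JI : is_ideal J by exact: fusion_ideal_ideal.
apply: (ideal_span_min (ideal_colon ('X_s ^+ #|[pred r | D r == s]|) JI)).
move=> _ [l [m [ml ->]]]; rewrite -coef_e_poly -coefCM.
apply: (@vanish_lowest_pow _ _ JI _ s (e_poly K n) (zero_order n D) _ l _ _ _ _ m ml).
- by move=> d x; apply: mpoly_div_nat.
- exact: e_poly_vanish.
- by move=> l'; apply: fusion_ideal_vanish.
- by move=> q qp; apply: zero_order_raise.
Qed.

(** A generator that is new for the exchanged levels is the coefficient of
z^(s i + (i - p)) in e(z)^i, which [vanish_pow_lowest] puts into J(D) + (e_s^p). *)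
Lemma fusion_ideal_exchange k (D : 'I_k -> nat) (s : 'I_n) (r0 r1 : 'I_k) p :
    (forall r, (s <= D r)%N) -> D r0 = s ->
    (s.+2 <= D r1)%N -> (D r1 <= maxn n s.+2)%N ->
    (forall r, (s.+2 <= D r)%N -> (D r1 <= D r)%N) ->
    fusion_ideal (zero_order n (exchange_levels D s r0 r1)) p ->
  exists q, fusion_ideal (zero_order n D) (p - 'X_s ^+ #|[pred r | D r == s]| * q).
Proof.
move=> Ds D0 D1 D1n D1min; set J := fusion_ideal (zero_order n D).
set b := 'X_s ^+ _.
have JI : is_ideal J by exact: fusion_ideal_ideal.
have JJ x : J x -> exists q, J (x - b * q) by exists 0; rewrite mulr0 subr0.
have J'I := ideal_add_principal b JI.
apply: (ideal_span_min J'I) => _ [l [m [ml ->]]].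
have [mz|zm] := ltnP m (zero_order n D l); first by apply/JJ/fusion_ideal_vanish/mz.
have [pl mp] := zero_order_exchange (ltn_ord s) Ds D0 D1 D1n D1min ml zm.
apply: (@vanish_pow_lowest _ _ J'I s _ _ l _ _ pl m mp).
  by move=> j js; apply/JJ/(e_poly_vanish Ds).
by rewrite coef_e_poly; exists 1; rewrite mulr1 subrr; case: JI.
Qed.

(** If all the variables lie in the ideal, its quotient consists of constants. *)
Lemma fusion_ideal_constant (w : nat -> nat) p :
  (n <= w 1)%N -> exists c, fusion_ideal w (p - c%:MP).
Proof.
move=> nw; have [J0 JD JM] := fusion_ideal_ideal w.
elim/mpoly_alg_ind: p => [c|i|p q [c pc] [d qd]|p q [c pc] [d qd]].
- by exists c; rewrite subrr.
- exists 0; rewrite mpolyC0 subr0 -coef_e_poly -[e_poly K n]expr1.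
  apply: fusion_ideal_vanish; exact: leq_trans nw.
- by exists (c + d); rewrite mpolyCD opprD addrACA; apply: JD.
- exists (c * d); have -> : p * q - (c * d)%:MP = q * (p - c%:MP) + c%:MP * (q - d%:MP).
    by rewrite mpolyCM; ring.
  by apply: JD; apply: JM.
Qed.

(** Downward induction on a lower bound s of the levels; for fixed s, induction on the
number of factors of level s. *)
Lemma annihilator_fusion_ideal k (D : 'I_k -> nat) p :
  p *: vacuum_tensor K n D = 0 -> fusion_ideal (zero_order n D) p.
Proof.
have kills k' (D' : 'I_k' -> nat) p' : fusion_ideal (zero_order n D') p' ->
    p' *: vacuum_tensor K n D' = 0 by exact/fusion_ideal_kills/fock_no_2torsion.
suff gen u : forall s, (s + u = n)%N -> forall k (D : 'I_k -> nat),
    (forall r, (s <= D r)%N) -> forall p, p *: vacuum_tensor K n D = 0 ->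
  fusion_ideal (zero_order n D) p by apply: (gen n 0%N).
elim: u => [|u IHu] s su {p}k {}D Ds p pD.
  have nw : (n <= zero_order n D 1)%N.
    rewrite -[X in (X <= _)%N]muln1 -[n in X in (X <= _)%N]card_ord -sum_nat_const.
    apply: leq_sum => m _; rewrite -/(level_count D m) (level_count_low Ds) //.
    by have := ltn_ord m; lia.
  (* all e_i kill the vacuum tensor, so a polynomial in its annihilator has constant term 0 *)
  have [c pc] := fusion_ideal_constant p nw.
  have := kills _ _ _ pc; rewrite scalerBl pD sub0r => /eqP; rewrite oppr_eq0 => /eqP cD.
  have [c0|c0] := eqVneq c 0; first by move: pc; rewrite c0 mpolyC0 subr0.
  have := e_actC_inj c0 cD; rewrite /vacuum_tensor => /malgP /(_ [ffun r => vacuum ((D r)%:Z - 1)]).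
  by rewrite mcoeffUU monalg.mcoeff0 => /eqP; rewrite oner_eq0.
have sn : (s < n)%N by lia.
suff inner l : forall k (D : 'I_k -> nat), #|[pred r | D r == s]| = l ->
    (forall r, (s <= D r)%N) -> forall p, p *: vacuum_tensor K n D = 0 ->
  fusion_ideal (zero_order n D) p by exact: inner (erefl _) Ds p pD.
elim: l => [|l IHl] {Ds pD}k {}D Dl Ds {}p pD.
  apply: (IHu s.+1) => //; first by lia.
  move=> r; rewrite ltn_neqAle Ds andbT eq_sym.
  by have := card0_eq Dl r; rewrite !inE => ->.
(* the level of the adjoined factor is at least n, so that all e_i kill it, and at
   least s + 2, so that a fermion can be taken from it *)
pose E r := oapp D (maxn n s.+2) (unlift ord0 r).
have Es r : (s <= E r)%N by rewrite /E; case: unliftP => [j _|_] /=; [apply: Ds|lia].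
have El : #|[pred r | E r == s]| = l.+1.
  by rewrite (card_add_factor (fun x => x == s)) Dl (_ : (_ == s) = false) //; lia.
have pE : p *: vacuum_tensor K n E = 0 by apply: annihilator_add_factor => //; apply: leq_maxl.
suff : fusion_ideal (zero_order n E) p.
  apply: ideal_span_min; first exact: fusion_ideal_ideal.
  move=> _ [i [m [mi ->]]]; apply: fusion_ideal_vanish.
  by rewrite zero_order_add_factor ?leq_maxl in mi.
have [r1 E1 E1min] : exists2 r1, (s.+2 <= E r1)%N & forall r, (s.+2 <= E r)%N -> (E r1 <= E r)%N.
  have E0 : (s.+2 <= E ord0)%N by rewrite /E unlift_none leq_maxr.
  by case: (@arg_minnP _ ord0 (fun r => (s.+2 <= E r)%N) E E0) => r1; exists r1.
have E1n : (E r1 <= maxn n s.+2)%N.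
  by have := E1min ord0; rewrite /E unlift_none /= leq_maxr; apply.
have /card_gt0P[r0] : (0 < #|[pred r | E r == s]|)%N by rewrite El.
rewrite inE => /eqP E0; pose s' := Ordinal sn.
have Ex : forall r, (s <= exchange_levels E s r0 r1 r)%N.
  by move=> r; rewrite /exchange_levels; do 2 (case: ifP => _; first by lia).
have [q pq] := @fusion_ideal_exchange _ E s' r0 r1 p Es E0 E1 E1n E1min
  (IHl _ _ (card_exchange Es E0 E1 El) Ex p (annihilator_exchange E0 E1 pE)).
have [d vd] := e_pow_vacuum_tensor K (s := s') Es El.
have qE : q *: vacuum_tensor K n (raise_bottom E s) = 0.
  apply: (@e_actC_inj _ ((-1) ^+ d *+ (l.+1)`!)).
    by rewrite mulrn_eq0 signr_eq0 orbF -lt0n fact_gt0.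
  rewrite scalerA mulrC -scalerA -vd scalerA mulrC.
  have := kills _ _ _ pq; rewrite scalerBl pE sub0r El => /eqP.
  by rewrite oppr_eq0 => /eqP.
have Er : forall r, (s.+1 <= raise_bottom E s r)%N.
  move=> r; rewrite /raise_bottom; case: (eqVneq (E r) s) => [_|Ers]; first by lia.
  by rewrite ltn_neqAle eq_sym Ers Es.
have qJ : fusion_ideal (zero_order n (raise_bottom E s)) q.
  by apply: (IHu s.+1) => //; lia.
have [_ JD _] := fusion_ideal_ideal (zero_order n E).
rewrite -[p](subrK ('X_s' ^+ #|[pred r | E r == s']| * q)); apply: JD => //.
exact: fusion_ideal_raise.
Qed.

End Annihilators.

(** * From levels to the partition *)

Lemma count_leq_sorted (s : seq nat) c m : sorted leq s -> (m < size s)%N ->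
  (count (fun a => a <= c)%N s <= m)%N = (c < nth 0%N s m)%N.
Proof.
elim: s m => //= x s IH m xs ms.
have xle : all (leq x) s by move: xs; rewrite (path_sortedE leq_trans) => /andP[].
have [xc|cx] := leqP x c.
  case: m ms => [|m] ms /=; first by rewrite ltnNge xc.
  exact: IH (path_sorted xs) ms.
have -> : count (fun a => a <= c)%N s = 0%N.
  apply/eqP; rewrite -leqn0 leqNgt -has_count; apply/hasPn => a /(allP xle) xa.
  by rewrite -ltnNge (leq_trans cx xa).
rewrite /= leq0n; case: m ms => [|m] ms /=; first by rewrite cx.
by rewrite (leq_trans cx) // (allP xle) ?mem_nth.
Qed.

Lemma sum_count_mem (s : seq nat) c : (forall a, a \in s -> (0 < a)%N) ->
  (\sum_(1 <= j < c.+1) count_mem j s)%N = count (fun a => a <= c)%N s.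
Proof.
move=> s0; elim: c => [|c IH].
  rewrite big_geq // (@eq_in_count _ _ pred0) ?count_pred0 // => a /s0.
  by case: a.
rewrite big_nat_recr //= IH; elim: s {s0 IH} => //= a s <-.
by rewrite addnACA; congr (_ + _)%N; case: ltngtP => //=; lia.
Qed.

Lemma card_ltn_ord k b : #|[pred r : 'I_k | (r < b)%N]| = minn k b.
Proof. by rewrite -sum_ltn_ord -sum1_card big_mkcond; apply: eq_bigr => r _; rewrite inE. Qed.

Section PartitionLevels.
Variables (n k : nat) (A : n.-tuple nat).
Hypotheses (A_pos : forall a : nat, a \in A -> (0 < a)%N) (A_sorted : sorted leq A).
Hypothesis A_last : last 0%N A = k.+1.

Definition partition_level (r : 'I_k) : nat := \sum_(1 <= j < r.+2) mult_in_A A j.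

(** For sorted A the level r is at most m exactly when the (m+1)-st entry exceeds
r + 1, so the count at m is that entry minus one. *)
Lemma zero_order_partition i :
  zero_order n partition_level i = (\sum_(a <- A) (i.+1 - a))%N.
Proof.
rewrite /zero_order (big_nth 0%N) size_tuple big_mkord; apply: eq_bigr => m _.
have mA : (m < size A)%N by rewrite size_tuple.
have am : (nth 0%N A m <= k.+1)%N.
  rewrite -A_last (last_nth 0%N); case e : (tval A) mA => [//|x s] mA /=.
  have := A_sorted; rewrite e => xs.
  apply: (sorted_leq_nth leq_trans leqnn 0%N xs) => //; first by rewrite inE.
have a0 : (0 < nth 0%N A m)%N by apply: A_pos; apply: mem_nth.
have -> : #|[pred r | (partition_level r <= m)%N]| = #|[pred r : 'I_k | (r < (nth 0%N A m).-1)%N]|.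
  apply: eq_card => r; rewrite !inE /partition_level /mult_in_A sum_count_mem //.
  by rewrite count_leq_sorted //; lia.
by rewrite card_ltn_ord; lia.
Qed.

Variable K : numFieldType.
Local Notation JA_A := (@JA K n A).

Lemma JA_fusion_ideal (p : {mpoly K[n]}) :
  p \in JA_A <-> fusion_ideal (zero_order n partition_level) p.
Proof.
have gen (g : {mpoly K[n]}) : JA_gen A g <-> exists i m,
    (m < zero_order n partition_level i)%N /\ g = (e_poly K n ^+ i)`_m.
  split=> [[i [m [_ mi ->]]]|[i [m [mi ->]]]]; exists i, m.
    by rewrite zero_order_partition.
  rewrite -zero_order_partition; split=> //; case: i mi => //.
  by rewrite /zero_order big1.
split=> [/asboolP[s [sJ ->]]|].
  elim: s sJ => [|c s IH] sJ; rewrite ?big_nil ?big_cons; first exact: IdealSpan0.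
  apply: IdealSpanMD; first by apply/gen/sJ; rewrite mem_head.
  by apply: IH => d ds; apply: sJ; rewrite inE ds orbT.
move=> pJ; apply/asboolP; elim: pJ => [|a g x /gen Gg _ [s [sJ ->]]].
  by exists [::]; rewrite big_nil.
exists ((a, g) :: s); split; last by rewrite big_cons.
by move=> c; rewrite inE => /predU1P[-> //|/sJ].
Qed.

Lemma vA_vacuum_tensor : vA K A k = vacuum_tensor K n partition_level.
Proof.
by congr << _ >>; apply/ffunP => r; rewrite !ffunE addrC.
Qed.

Lemma JA_annihilator (p : {mpoly K[n]}) : (p \in JA_A) = (p *: vA K A k == 0).
Proof.
rewrite vA_vacuum_tensor; apply/idP/eqP => [/JA_fusion_ideal|pv].
  exact/fusion_ideal_kills/fock_no_2torsion.
exact/JA_fusion_ideal/annihilator_fusion_ideal.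
Qed.

Local Notation class p := (\pi_({ideal_quot JA_A}) p)%qT.

Lemma WA_class_scale (p q : {mpoly K[n]}) :
  class p = class q -> p *: vA K A k = q *: vA K A k.
Proof.
move=> /eqP; rewrite -Quotient.idealrBE JA_annihilator scalerBl subr_eq0.
by move/eqP.
Qed.

Lemma WA_to_fock_subproof (p : {mpoly K[n]}) : in_cyclic (vA K A k) (p *: vA K A k).
Proof. by apply/asboolP; exists p. Qed.

(** The class of P is sent to P v_A, through the canonical representative of the class. *)
Definition WA_to_fock (x : WA K A) : WA_fock K A k :=
  Sub (repr (x : {ideal_quot JA_A}) *: vA K A k) (WA_to_fock_subproof _).

Lemma WA_to_fock_class (p : {mpoly K[n]}) : val (WA_to_fock (class p)) = p *: vA K A k.
Proof. by rewrite SubK; apply: WA_class_scale; rewrite reprK. Qed.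

Lemma WA_to_fock_is_linear : linear WA_to_fock.
Proof.
move=> a x y; apply: val_inj.
have -> : a *: x + y =
    class (a * repr (x : {ideal_quot JA_A}) + repr (y : {ideal_quot JA_A})) :> WA K A.
  by rewrite rmorphD rmorphM /= !reprK.
rewrite WA_to_fock_class scalerDl -scalerA.
by rewrite linearP.
Qed.

HB.instance Definition _ := GRing.isLinear.Build {mpoly K[n]} (WA K A) (WA_fock K A k) *:%R
  WA_to_fock WA_to_fock_is_linear.

Lemma WA_to_fock_bij : bijective WA_to_fock.
Proof.
pose g (w : WA_fock K A k) : WA K A := class (projT1 (cid (asboolW (valP w)))).
exists g => [x|w].
  rewrite /g; case: cid => p /= pE; rewrite -[RHS](@reprK _ {ideal_quot JA_A}).
  by apply/eqP; rewrite -Quotient.idealrBE JA_annihilator scalerBl -pE -WA_to_fock_class reprK subrr.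
by apply: val_inj; rewrite /g; case: cid => p /= pE; apply: etrans (WA_to_fock_class p) _.
Qed.

Lemma WA_fock_isomorphism : exists f : {linear WA K A -> WA_fock K A k}, bijective f.
Proof. by exists WA_to_fock; exact: WA_to_fock_bij. Qed.

End PartitionLevels.

Theorem theorem2p1 (R : realType) (n k : nat) (A : n.-tuple nat)
    (A_pos : forall a : nat, a \in A -> (0 < a)%N)
    (A_sorted : sorted leq A)
    (A_last : last 0%N A = k.+1) :
  exists f : {linear WA R[i] A -> WA_fock R[i] A k}, bijective f.
Proof. exact: WA_fock_isomorphism. Qed.
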